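(* In the setting described in the context, for every $x\in\mathcal X$ and every $0<\delta\le\bar\delta$, $$\mathcal G^c(x)\le\mathcal G_\delta(x)+D\|d_y(x)\|\,\omega_y^c(x,\delta),$$ where $D=\operatorname{diam}(\mathcal X)$. In particular, for a target accuracy $\epsilon>0$, suppose that $x$ is a $(\delta,2\epsilon/3)$-Bi-ZOL stationary point, i.e. $\mathcal G_\delta(x)\le 2\epsilon/3$, and that $$D\|d_y(x)\|\,\omega_y^c(x,\delta)\le\frac{\epsilon}{3}.\qquad(\ast)$$ Then $x$ is an $\epsilon$-Clarke Frank--Wolfe stationary point, i.e. $\mathcal G^c(x)\le\epsilon$. If, in addition, the local set variation satisfies $\omega_y^c(x,\delta)\le L_{J,c}(x)\,\delta$, then: if $\|d_y(x)\|L_{J,c}(x)>0$ (e.g., piecewise $C^{1,1}$ response with $\delta$-regularity), condition $(\ast)$ is equivalent to $$\delta\le\frac{\epsilon}{3D\|d_y(x)\|L_{J,c}(x)};$$ if $\|d_y(x)\|L_{J,c}(x)=0$ (e.g., piecewise affine response with $\delta$-regularity), the structural-bias term $D\|d_y(x)\|\,\omega_y^c(x,\delta)$ vanishes and no extra upper bound on $\delta$ is needed.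
   Context: $\|\cdot\|$ is the Euclidean norm for vectors and the corresponding operator norm for matrices; $\operatorname{dist}(z,\mathcal S)=\inf_{s\in\mathcal S}\|z-s\|$; $\mathbb B_n$ is the closed unit ball of $\mathbb R^n$; $B_\delta(x)=\{s:\|s-x\|\le\delta\}$. Response mapping. $\mathcal X\subset\mathbb R^n$ is nonempty, convex and compact, and $\mathcal N$ is an open neighborhood of $\mathcal X$. For each $x\in\mathcal N$ the lower-level solution set $\arg\min_{\xi\in\mathcal Y}g(x,\xi)$ (with $\mathcal Y\subseteq\mathbb R^m$) is a singleton $\{y(x)\}$, and the response map $y:\mathcal N\to\mathbb R^m$ is locally Lipschitz. A number $\bar\delta>0$ with $\mathcal X+\bar\delta\mathbb B_n\subseteq\mathcal N$ is fixed; on $\mathcal X+\bar\delta\mathbb B_n$, $y$ is bounded and $L_y$-Lipschitz. Smoothing. $y_\delta(u)=\mathbb E_{\xi\sim\mathrm{Unif}(\mathbb B_n)}[y(u+\delta\xi)]$, with Jacobian $\mathrm Jy_\delta(u)\in\mathbb R^{m\times n}$. Upper-level objective. $\varphi\in C^1(\mathbb R^n\times\mathbb R^m)$ with partial gradients $\nabla_1\varphi$ (in the first argument) and $\nabla_2\varphi$ (in the second). There are finite constants $L_{1x},L_{1y},L_{2x},L_{2y},M_y>0$ such that, for all relevant pairs $(x,y),(x',y')$ at which these gradients are evaluated, $\|\nabla_1\varphi(x,y)-\nabla_1\varphi(x',y')\|\le L_{1x}\|x-x'\|+L_{1y}\|y-y'\|$, $\|\nabla_2\varphi(x,y)-\nabla_2\varphi(x',y')\|\le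 L_{2x}\|x-x'\|+L_{2y}\|y-y'\|$, and $\|\nabla_2\varphi(x,y)\|\le M_y$. Derived objects. $\tilde\varphi(x)=\varphi(x,y(x))$, $d_x(x)=\nabla_1\varphi(x,y(x))$, $d_y(x)=\nabla_2\varphi(x,y(x))$, and the Bi-ZOL approximate hypergradient is $g_\delta(x)=d_x(x)+\mathrm Jy_\delta(x)^\top d_y(x)$. Clarke objects. For a locally Lipschitz map $F$ on an open set, differentiable on the full-measure set $\Omega_F$, the Clarke generalized Jacobian is $\mathrm J^cF(x)=\operatorname{conv}\{\lim_k \mathrm JF(x^k): x^k\to x,\ x^k\in\Omega_F\}$; for a scalar locally Lipschitz function $f$, the Clarke subdifferential is $\partial^cf(x)=\operatorname{conv}\{\lim_k\nabla f(x^k):x^k\to x,\ x^k\in\Omega_f\}$. Local set variation: $\omega_y^c(x,\delta)=\sup_{\|s-x\|\le\delta}\ \sup_{V\in\mathrm J^cy(s)}\operatorname{dist}(V,\mathrm J^cy(x))$; $L_{J,c}(x)$ denotes a constant (depending on $x$). Frank--Wolfe gaps. Clarke gap: $\mathcal G^c(x)=\min_{g\in\partial^c\tilde\varphi(x)}\max_{z\in\mathcal X}\langle z-x,-g\rangle$. Bi-ZOL gap: $\mathcal G_\delta(x)=\max_{z\in\mathcal X}\langle z-x,-g_\delta(x)\rangle$. Terms in the parenthetical examples. The response is piecewise $C^{1,1}$ (resp. piecewise affine) if, on a neighborhood of $\mathcal X$, it is continuous and, over a finite partition $\{\mathcal R_i\}$ (polyhedral in the affine case), $y=y_i$ on $\mathcal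 R_i$ with $y_i$ of class $C^{1,1}$ near $\overline{\mathcal R_i}$ (resp. affine). The point $x$ is $\delta$-regular if every $\mathcal R_i$ that meets $B_\delta(x)$ satisfies $x\in\overline{\mathcal R_i}$.
   Formalization: The equivalence of (∗) with the δ-bound fails if ω<Lδ (constant y), so it is stated with ω replaced by Lδ, or literally when ω=Lδ; the δ-bound still implies (∗) in general. If D=0 the bound is +∞. The parenthetical piecewise examples are left out. *)

(* Defs.v *)
From HB Require Import structures.
From mathcomp Require Import all_boot all_order all_algebra.
From mathcomp Require Import all_classical all_reals all_analysis.
From mathcomp Require Import measurable_realfun.

Set Implicit Arguments.
Unset Strict Implicit.
Unset Printing Implicit Defensive.

Import Order.TTheory GRing.Theory Num.Theory.
Import numFieldNormedType.Exports.

Local Open Scope classical_set_scope.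
Local Open Scope ring_scope.

(* Vectors of R^n are row vectors 'rV[R]_n.  MathComp-Analysis equips 'rV[R]_n
   and 'M[R]_(m, n) with the max norm: it is used below only through the topology
   (open, compact, limits, differentiability), which is the usual one.  Every
   quantitative norm is one of the two Euclidean norms defined here. *)

Section euclidean.
Context {R : realType}.

Definition dotv n (u v : 'rV[R]_n) : R := \sum_(i < n) u 0 i * v 0 i.

Definition enorm n (v : 'rV[R]_n) : R := Num.sqrt (dotv v v).

Definition closed_eball n (x : 'rV[R]_n) (r : R) : set 'rV[R]_n :=
  [set s | enorm (s - x) <= r].

Definition diam n (A : set 'rV[R]_n) : R :=
  sup [set enorm (p.1 - p.2) | p in A `*` A].

(* A + r B_n, where B_n is the closed unit ball *)
Definition thicken n (A : set 'rV[R]_n) (r : R) : set 'rV[R]_n :=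
  [set a + r *: b | a in A & b in closed_eball 0 1].

(* [v *m V^T] is the row vector representing the column V v. *)
Definition opnorm m n (V : 'M[R]_(m, n)) : R :=
  sup [set enorm (v *m V^T) | v in closed_eball (0 : 'rV[R]_n) 1].

(* The distance to the empty set is +oo. *)
Definition mxdist m n (V : 'M[R]_(m, n)) (S : set 'M[R]_(m, n)) : \bar R :=
  ereal_inf [set (opnorm (V - W))%:E | W in S].

Definition lipschitz_with m n (K : R) (A : set 'rV[R]_n)
    (F : 'rV[R]_n -> 'rV[R]_m) : Prop :=
  forall u v, A u -> A v -> enorm (F u - F v) <= K * enorm (u - v).

Definition locally_lipschitz m n (A : set 'rV[R]_n)
    (F : 'rV[R]_n -> 'rV[R]_m) : Prop :=
  forall x, A x -> exists K, exists2 U, nbhs x U & lipschitz_with K (A `&` U) F.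

Definition argmin (T : Type) (S : set T) (f : T -> R) : set T :=
  [set s | S s /\ forall t, S t -> f s <= f t].

End euclidean.

Section lebesgue_measure_Rn.
Context {R : realType}.

Section sigma_finite_facts.
Context d1 d2 (T1 : measurableType d1) (T2 : measurableType d2).

Lemma sigma_finite_pushforward (mu : set T1 -> \bar R)
    (f : T1 -> T2) (g : T2 -> T1) :
  measurable_fun setT g -> cancel f g ->
  sigma_finite setT mu -> sigma_finite setT (pushforward mu f).
Proof.
move=> mg fK [F FT FP].
exists (fun i => g @^-1` F i); first by rewrite -preimage_bigcup -FT.
move=> i; have [mF Foo] := FP i; split.
  by rewrite -[X in measurable X]setTI; exact: mg.
rewrite /pushforward (_ : f @^-1` _ = F i)//.
by apply/seteqP; split => x /=; rewrite fK.
Qed.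

Lemma sigma_finite_product (m1 : {sigma_finite_measure set T1 -> \bar R})
    (m2 : {sigma_finite_measure set T2 -> \bar R}) :
  sigma_finite setT (m1 \x m2)%E.
Proof.
have /sigma_finiteP[F [TF ndF Foo]] := sigma_finiteT m1.
have /sigma_finiteP[G [TG ndG Goo]] := sigma_finiteT m2.
exists (fun n => F n `*` G n).
  rewrite -setXTT TF TG predeqE => -[x y]; split; last first.
    by move=> [n _ []/= ? ?]; split; exists n.
  move=> [/= [n _ Fnx] [k _ Gky]]; exists (maxn n k) => //; split.
    by move: x Fnx; exact/subsetPset/ndF/leq_maxl.
  by move: y Gky; exact/subsetPset/ndG/leq_maxr.
move=> k; have [? ?] := Foo k; have [? ?] := Goo k.
split; first exact: measurableX.
by rewrite product_measure1E// lte_mul_pinfty// ge0_fin_numE.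
Qed.

End sigma_finite_facts.

Definition tcons n (p : R * n.-tuple R) : n.+1.-tuple R :=
  [the n.+1.-tuple R of p.1 :: p.2].

Definition tuncons n (t : n.+1.-tuple R) : R * n.-tuple R :=
  (tnth t ord0, [tuple of behead t]).

Lemma measurable_tcons n : measurable_fun setT (@tcons n).
Proof. by apply: measurable_cons. Qed.

HB.instance Definition _ n :=
  isMeasurableFun.Build _ _ _ _ (@tcons n) (@measurable_tcons n).

Lemma measurable_tuncons n : measurable_fun setT (@tuncons n).
Proof.
apply/measurable_fun_pairP; split; first exact: measurable_tnth.
exact: measurable_behead.
Qed.

Lemma tconsK n : cancel (@tcons n) (@tuncons n).
Proof. by move=> [a t]; congr pair; apply/val_inj. Qed.

Section lebesgue_step.
Variables (n : nat) (mu : {sigma_finite_measure set (n.-tuple R) -> \bar R}).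

Definition lebesgue_step : set (n.+1.-tuple R) -> \bar R :=
  pushforward ((@lebesgue_measure R) \x mu)%E (@tcons n).

Let lebesgue_step0 : lebesgue_step set0 = 0%E.
Proof. by rewrite /lebesgue_step /pushforward preimage_set0 measure0. Qed.

Let lebesgue_step_ge0 A : (0 <= lebesgue_step A)%E.
Proof. by rewrite /lebesgue_step /pushforward measure_ge0. Qed.

Let lebesgue_step_sigma_additive : semi_sigma_additive lebesgue_step.
Proof.
move=> F mF tF mUF; rewrite /lebesgue_step /pushforward preimage_bigcup.
have mpre A : measurable A -> measurable (@tcons n @^-1` A).
  by move=> mA; rewrite -[X in measurable X]setTI; exact: measurable_tcons.
apply: measure_semi_sigma_additive.
- by move=> k; exact: mpre.
- apply/trivIsetP => i j _ _ ij; rewrite -preimage_setI.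
  by move/trivIsetP : tF => /(_ _ _ _ _ ij) ->//; rewrite preimage_set0.
- by rewrite -preimage_bigcup; exact: mpre.
Qed.

HB.instance Definition _ := isMeasure.Build _ _ _ lebesgue_step
  lebesgue_step0 lebesgue_step_ge0 lebesgue_step_sigma_additive.

Let lebesgue_step_sigma_finite : sigma_finite setT lebesgue_step.
Proof.
apply: (sigma_finite_pushforward (@measurable_tuncons n) (@tconsK n)).
exact: (sigma_finite_product (@lebesgue_measure R) mu).
Qed.

HB.instance Definition _ := Measure_isSigmaFinite.Build _ _ _ lebesgue_step
  lebesgue_step_sigma_finite.

End lebesgue_step.

(* Lebesgue measure on the Borel sets of R^n (n.-tuple R carries the product
   sigma-algebra): a unit point mass on R^0, then the image of
   lebesgue_measure \x lebesgue_tuple n under (a, t) |-> a :: t. *)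
Fixpoint lebesgue_tuple (n : nat) :
    {sigma_finite_measure set (n.-tuple R) -> \bar R} :=
  match n with
  | 0 => @dirac _ (0.-tuple R) [tuple] R
  | n'.+1 => lebesgue_step (lebesgue_tuple n')
  end.

Definition rV_of_tuple n (t : n.-tuple R) : 'rV[R]_n := \row_i tnth t i.

Definition tuple_ball n : set (n.-tuple R) :=
  [set t | enorm (rV_of_tuple t) <= 1].

Lemma measurable_tuple_ball n : measurable (@tuple_ball n).
Proof.
have enormE t : enorm (rV_of_tuple t) = Num.sqrt (\sum_(i < n) tnth t i ^+ 2).
  by congr Num.sqrt; apply: eq_bigr => i _; rewrite !mxE expr2.
rewrite (_ : @tuple_ball n =
    setT `&` [set t | (\sum_(i < n) tnth t i ^+ 2)%:E <= 1]%E); last first.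
  have sqrt_le1 (r : R) : (Num.sqrt r <= 1) = (r <= 1).
    by rewrite -[in LHS]sqrtr1 ler_sqrt.
  by rewrite setTI; apply/seteqP; split => t;
    rewrite /tuple_ball /= enormE lee_fin sqrt_le1.
apply: measurable_lee => //.
apply/measurable_EFinP; apply: measurable_sum => i.
by apply: measurable_funX; exact: measurable_tnth.
Qed.

(* Unif(B_n), the normalized restriction of Lebesgue measure to the unit ball;
   the second argument of [mnormalize] is a default value, used only if the
   volume of the ball were 0 or +oo. *)
Definition uniform_ball n : probability (n.-tuple R) R :=
  mnormalize (mrestr (lebesgue_tuple n) (@measurable_tuple_ball n))
    (@dirac _ (n.-tuple R) [tuple of nseq n 0] R).

End lebesgue_measure_Rn.

Section smoothing.
Context {R : realType}.

(* y_delta(u) = E_(xi ~ Unif(B_n)) [y (u + delta xi)], coordinatewise. *)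
Definition smoothing n m (y : 'rV[R]_n -> 'rV[R]_m) (delta : R)
    (u : 'rV[R]_n) : 'rV[R]_m :=
  \row_j fine ('E_(uniform_ball n)
    [(fun t => y (u + delta *: rV_of_tuple t) 0 j)%R])%E.

End smoothing.

Section clarke.
Context {R : realType}.

(* The jacobian of the library acts on row vectors from the right; [Jac F x] is
   the usual m x n matrix of partial derivatives dF_i / dx_j. *)
Definition Jac n m (F : 'rV[R]_n -> 'rV[R]_m) (x : 'rV[R]_n) : 'M[R]_(m, n) :=
  ('J F x)^T.

Definition grad n (f : 'rV[R]_n -> R) (x : 'rV[R]_n) : 'rV[R]_n :=
  \row_j 'D_(delta_mx 0 j) f x.

Definition conv_hull m n (A : set 'M[R]_(m, n)) : set 'M[R]_(m, n) :=
  smallest (@convex_set R 'M[R]_(m, n)) A.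

(* N is the open set on which F (resp. f) is considered, so that
   [set s | N s /\ differentiable F s] is Omega_F. *)
Definition clarke_jacobian n m (N : set 'rV[R]_n) (F : 'rV[R]_n -> 'rV[R]_m)
    (x : 'rV[R]_n) : set 'M[R]_(m, n) :=
  conv_hull [set V | exists u : nat -> 'rV[R]_n,
    [/\ forall k, N (u k) /\ differentiable F (u k),
        u @ \oo --> x &
        (fun k => Jac F (u k)) @ \oo --> V]].

Definition clarke_subdiff n (N : set 'rV[R]_n) (f : 'rV[R]_n -> R)
    (x : 'rV[R]_n) : set 'rV[R]_n :=
  conv_hull [set v | exists u : nat -> 'rV[R]_n,
    [/\ forall k, N (u k) /\ differentiable f (u k),
        u @ \oo --> x &
        (fun k => grad f (u k)) @ \oo --> v]].

Definition set_variation n m (N : set 'rV[R]_n) (F : 'rV[R]_n -> 'rV[R]_m)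
    (x : 'rV[R]_n) (delta : R) : \bar R :=
  ereal_sup [set ereal_sup [set mxdist V (clarke_jacobian N F x)
                           | V in clarke_jacobian N F s]
            | s in closed_eball x delta].

End clarke.

Section bilevel.
Context {R : realType} {n m : nat}.
Variables (X N : set 'rV[R]_n) (y : 'rV[R]_n -> 'rV[R]_m).
Variable phi : 'rV[R]_n * 'rV[R]_m -> R.

Definition grad1 (p : 'rV[R]_n * 'rV[R]_m) : 'rV[R]_n :=
  grad (fun u => phi (u, p.2)) p.1.

Definition grad2 (p : 'rV[R]_n * 'rV[R]_m) : 'rV[R]_m :=
  grad (fun v => phi (p.1, v)) p.2.

Definition C1 : Prop :=
  [/\ forall p, differentiable phi p, continuous grad1 & continuous grad2].

Definition phi_tilde (x : 'rV[R]_n) : R := phi (x, y x).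

Definition d_x (x : 'rV[R]_n) : 'rV[R]_n := grad1 (x, y x).

Definition d_y (x : 'rV[R]_n) : 'rV[R]_m := grad2 (x, y x).

(* [d_y x *m J] is the row vector representing J^T d_y(x). *)
Definition bizol_grad (delta : R) (x : 'rV[R]_n) : 'rV[R]_n :=
  d_x x + d_y x *m Jac (smoothing y delta) x.

(* max_(z in X) <z - x, - g>, the maximum being attained for X compact *)
Definition fw_gap (x g : 'rV[R]_n) : R :=
  sup [set dotv (z - x) (- g) | z in X].

(* The infimum is a minimum (the Clarke subdifferential is compact); as an
   extended real, it would be +oo on an empty subdifferential. *)
Definition clarke_gap (x : 'rV[R]_n) : \bar R :=
  ereal_inf [set (fw_gap x g)%:E | g in clarke_subdiff N phi_tilde x].

Definition bizol_gap (delta : R) (x : 'rV[R]_n) : R :=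
  fw_gap x (bizol_grad delta x).

Definition structural_bias (delta : R) (x : 'rV[R]_n) : \bar R :=
  ((diam X * enorm (d_y x))%:E * set_variation N y x delta)%E.

Definition bizol_stationary (delta eta : R) (x : 'rV[R]_n) : Prop :=
  bizol_gap delta x <= eta.

Definition clarke_fw_stationary (eps : R) (x : 'rV[R]_n) : Prop :=
  (clarke_gap x <= eps%:E)%E.

End bilevel.

(* Main.v *)
Require Import Defs.
From HB Require Import structures.
From mathcomp Require Import all_boot all_order all_algebra.
From mathcomp Require Import all_classical all_reals all_analysis.
From mathcomp Require Import measurable_realfun.
From mathcomp Require Import unstable ring lra.

(** The Jacobian of the smoothed response is an average of Jacobians
    [Jac y s] over [closed_eball x delta].  Every such [Jac y s] lies within
    the set variation of the convex set [clarke_jacobian N y x], hence so does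
    the average; transporting a near-optimal element through the easy half of
    the Clarke chain rule bounds the Clarke gap by Cauchy-Schwarz.

    The averaging step and the nonemptiness of the Clarke Jacobian rest on
    Rademacher's theorem, which is proved by induction on the dimension.  On the
    line, a monotone Lipschitz function is the integral of the Radon-Nikodym
    derivative of its Stieltjes measure.  In the inductive step, the slices of
    [f] are differentiable almost everywhere in both groups of variables, and
    the one-dimensional density theorem glues the partial expansions: near
    [cons_row a v], any point [cons_row (a + b) v] can be replaced, at cost
    [o(b)], by a point of the line at which the expansion in the last variables
    holds with the same slope and the same radius. *)

Set Implicit Arguments.
Unset Strict Implicit.
Unset Printing Implicit Defensive.

Import Order.TTheory GRing.Theory Num.Theory.
Import numFieldNormedType.Exports.

Local Open Scope classical_set_scope.
Local Open Scope ring_scope.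

(** * Lipschitz functions on the real line *)

(** The response is Lipschitz only near [closed_eball x delta], whereas slicing and dominated
    convergence want a function that is Lipschitz everywhere. Compactness leaves a margin around the
    ball inside [N], and an extension from the enlarged ball agrees with [y] under every small
    translation of the averaging ball. Measurability is the other obstacle: differentiability sets
    become Borel once tolerances, slopes and radii range over countable families, which is why a
    slope is first allowed to depend on its tolerance, and Jacobians are represented by truncated
    limits superior of difference quotients. Distances to the Clarke Jacobian are infima, so
    elements are chosen up to an error [e] that tends to 0 at the end. The averaging argument uses
    the inner product behind the Frobenius distance, the conclusion the operator norm; comparing the
    two affects only errors that vanish in the limit. *)

Section lipschitz_real_line.
Context {R : realType}.
Local Notation lambda := (@lebesgue_measure R).

(** Both set functions are outer measures built from half-open intervals, so covers can be compared
    directly, for an arbitrary [A]: a cover of total length below [e / (K + 1)] has total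
    [F]-increment at most [e]. *)
Lemma le_measure_extension_null (F : cumulative R R) (K : R) (A : set R) :
  (forall s t, s <= t -> F t - F s <= K * (t - s)) ->
  lambda A = 0%E -> lebesgue_stieltjes_measure F A = 0%E.
Proof.
move=> FK A0.
have K0 : 0 <= K.
  have := FK 0 1 ler01; rewrite subr0 mulr1; apply: le_trans.
  by rewrite subr_ge0 cumulative_is_nondecreasing.
apply/eqP; rewrite eq_le measure_ge0 andbT.
apply/lee_addgt0Pr => e e0; rewrite add0e.
have e'0 : 0 < e / (K + 1) by rewrite divr_gt0// ltr_wpDl.
pose S := [set (\sum_(0 <= k <oo) wlength idfun (B k))%E
          | B in @measurable_cover _ (ocitv_type R) A].
(* [lebesgue_measure] unfolds to this infimum over covers, with [idfun] as cumulative function. *)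
have S0 : ereal_inf S = 0%E := A0.
have Sfin : ereal_inf S \is a fin_num by rewrite S0.
have [_ [B [mB AB] <-]] := lb_ereal_inf_adherent e'0 Sfin.
rewrite S0 add0e => BA.
apply: (@le_trans _ _ (\sum_(0 <= k <oo) wlength F (B k))%E).
  by apply: ereal_inf_lbound; exists B.
apply: (@le_trans _ _ (\sum_(0 <= k <oo) (K%:E * wlength idfun (B k)))%E).
  apply: lee_nneseries => [k _ _|k _]; first exact: wlength_ge0.
  have [[a b]/= _ <-] := mB k; rewrite !wlength_itv/= !lte_fin.
  case: ifPn => ab; last by rewrite mule0.
  by rewrite -!EFinB -EFinM lee_fin FK// ltW.
rewrite nneseriesZl; last by move=> k _; exact: wlength_ge0.
apply: (le_trans (lee_wpmul2l _ (ltW BA))); first by rewrite lee_fin.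
rewrite -EFinM lee_fin mulrCA ger_pMr// ler_pdivrMr ?ltr_wpDl//.
by rewrite mul1r lerDl.
Qed.

Lemma cumulative_ae_derivable (F : cumulative R R) (K : R) :
  (forall s t, s <= t -> F t - F s <= K * (t - s)) ->
  {ae lambda, forall x, derivable F x 1}.
Proof.
move=> FK.
pose M (k : nat) : R := k%:R.
pose D k : set (measurableTypeR R) := `]- M k, M k]%classic.
have mD k : measurable (D k) by exact: measurable_itv.
have FD k : (lebesgue_stieltjes_measure F (D k) < +oo)%E.
  rewrite /lebesgue_stieltjes_measure /measure_extension measurable_mu_extE/=; last first.
    by exists (- M k, M k).
  by rewrite wlength_itv/=; case: ifPn => _; rewrite -?EFinB ltry.
have FDoc k x : D k x ->
    lebesgue_stieltjes_measure F `]- M k, x]%classic = (F x - F (- M k))%:E.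
  rewrite /D/= in_itv/= => /andP[kx xk].
  rewrite /lebesgue_stieltjes_measure /measure_extension measurable_mu_extE/=; last first.
    by exists (- M k, x).
  by rewrite wlength_itv/= lte_fin kx.
(* On the window from [- M k] to [M k] the Stieltjes measure is finite, which allows the
   Radon-Nikodym theorem; the countably many exceptional sets are then united. *)
suff H k : {ae lambda, forall x, - M k < x < M k -> derivable F x 1}.
  apply: negligibleS (negligible_bigcup H) => x /= Fx.
  exists (Num.bound x) => //= H'; apply: Fx; apply: H'.
  by rewrite /M ltrNl ltrNbound ltr_bound.
pose nu := mfrestr (mD k) (FD k).
have nul : nu `<< lambda.
  apply/null_content_dominatesP => A mA A0.
  have B0 := le_measure_extension_null FK A0.
  rewrite /nu /mfrestr /mrestr.
  apply/eqP; rewrite eq_le measure_ge0 andbT -B0 le_measure ?inE//.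
  exact: measurableI.
have [g [g0 gfin gint gE]] := radon_nikodym_sigma_finite nul.
have gint' : lambda.-integrable setT (EFin \o (fine \o g)).
  by rewrite (_ : _ \o _ = g)//; apply/funext => x/=; rewrite fineK.
have gintS z : lambda.-integrable `]-oo, z] (EFin \o (fine \o g)).
  by apply: integrableS gint' => //; exact: measurable_itv.
(* Lebesgue differentiation: the primitive of the density is derivable almost everywhere, and near a
   point of the window it equals [F] up to the constant [F (- M k)]. *)
have := FTC1Ny gintS (open_integrable_locally openT gint').
apply: filterS; first exact: (ae_filter_ringOfSetsType lambda).
move=> x [dx _] /andP[kx xk].
have dx' : derivable ((fun z => \int[lambda]_(t in `]-oo, z]) fine (g t))
    \+ cst (F (- M k))) x 1 by apply: derivableD.
apply: near_eq_derivable dx' => //.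
near=> z => /=.
have Dz : D k z.
  rewrite /D/= in_itv/=; apply/andP; split.
    by near: z; exact: lt_nbhsr.
  by apply/ltW; near: z; exact: lt_nbhsl.
rewrite /Rintegral.
have -> : (\int[lambda]_(t in `]-oo, z]) (fine (g t))%:E =
    (F z - F (- M k))%:E)%E.
  rewrite -(FDoc _ _ Dz) (_ : lebesgue_stieltjes_measure F _ = nu `]-oo, z]%classic).
    have -> : nu `]-oo, z]%classic = (\int[lambda]_(t in `]-oo, z]) g t)%E.
      by apply: gE; exact: measurable_itv.
    by apply: eq_integral => t _; rewrite fineK.
  rewrite /nu /mfrestr /mrestr; congr (lebesgue_stieltjes_measure F _).
  apply/seteqP; split => t; rewrite /D/= !in_itv/=.
    move=> /andP[-> tz]; split => //=; rewrite (le_trans tz)//.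
    by move: Dz; rewrite /D/= in_itv/= => /andP[].
  by move=> [-> /andP[-> _]].
by rewrite /= subrK.
Unshelve. all: by end_near. Qed.

(** Adding [L * x] makes [f] nondecreasing, with slopes at most [L + L]; the linear term is
    subtracted at the end. *)
Lemma lipschitz_ae_derivable (f : R -> R) (L : R) :
  (forall s t, `|f s - f t| <= L * `|s - t|) ->
  {ae lambda, forall x, derivable f x 1}.
Proof.
move=> fL.
pose F x := f x + L * x.
have ndF : nondecreasing F.
  move=> s t st; rewrite /F; have := fL t s.
  rewrite [X in _ * X]ger0_norm ?subr_ge0// ler_norml => /andP[+ _].
  by lra.
have cF : continuous F.
  move=> x; apply: cvgD; last by apply: cvgM; [exact: cvg_cst|exact: cvg_id].
  apply/cvgrPdist_le => e e0.
  have d0 : 0 < e / (`|L| + 1) by rewrite divr_gt0// ltr_wpDl.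
  near=> t; apply: (le_trans (fL _ _)).
  apply: (@le_trans _ _ ((`|L| + 1) * (e / (`|L| + 1)))); last first.
    by rewrite mulrC divfK// gt_eqF// ltr_wpDl.
  apply: (@le_trans _ _ ((`|L| + 1) * `|x - t|)).
    by apply: ler_wpM2r => //; have := ler_norm L; lra.
  apply: ler_wpM2l; first by rewrite addr_ge0.
  by near: t; apply: cvgr_dist_le => //; exact: cvg_id.
pose FF : cumulative R R := HB.pack_for (cumulative R R) F
  (isCumulative.Build R _ R F ndF (right_continuousW cF)).
have FK s t : s <= t -> FF t - FF s <= (L + L) * (t - s).
  move=> st; rewrite /= /F; have := fL t s.
  rewrite [X in _ * X]ger0_norm ?subr_ge0// ler_norml => /andP[_].
  by lra.
have := cumulative_ae_derivable FK.
apply: filterS; first exact: (ae_filter_ringOfSetsType lambda).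
move=> x dx.
rewrite (_ : f = F \- (fun x => L * x)); last first.
  by apply/funext => t; rewrite /F/= addrK.
by apply: derivableB => //; apply: derivableM => //.
Unshelve. all: by end_near. Qed.

End lipschitz_real_line.

(** * Borel sets of R^n *)

Section vectors.
Context {R : realType}.

Lemma row_norm_leP n (v : 'rV[R]_n) (e : R) : 0 <= e ->
  reflect (forall i, `|v 0 i| <= e) (`|v| <= e).
Proof.
move=> e0; rewrite /Num.norm/= mx_normrE.
apply: (iffP (bigmax_leP _ _ _ _)) => [[_ ve] i|ve]; first exact: (ve (0, i)).
by split=> // -[i j] _ /=; rewrite ord1; exact: ve.
Qed.

Lemma coord_le_norm n (v : 'rV[R]_n) i : `|v 0 i| <= `|v|.
Proof. by have /row_norm_leP := lexx `|v|; apply. Qed.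

Lemma dotv_le n (u v : 'rV[R]_n) : `|dotv u v| <= n%:R * `|u| * `|v|.
Proof.
rewrite /dotv; apply: (le_trans (ler_norm_sum _ _ _)).
rewrite (@le_trans _ _ (\sum_(i < n) `|u| * `|v|))//; last first.
  by rewrite sumr_const card_ord -mulrA mulr_natl.
by apply: ler_sum => i _; rewrite normrM ler_pM ?coord_le_norm.
Qed.

Lemma dotvDl n (u v w : 'rV[R]_n) : dotv (u + v) w = dotv u w + dotv v w.
Proof.
by rewrite /dotv -big_split/=; apply: eq_bigr => i _; rewrite !mxE mulrDl.
Qed.

Lemma dotvNl n (u w : 'rV[R]_n) : dotv (- u) w = - dotv u w.
Proof.
by rewrite /dotv -sumrN; apply: eq_bigr => i _; rewrite !mxE mulNr.
Qed.

Lemma dotvBl n (u v w : 'rV[R]_n) : dotv (u - v) w = dotv u w - dotv v w.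
Proof. by rewrite dotvDl dotvNl. Qed.

Lemma dotvZl n (a : R) (u w : 'rV[R]_n) : dotv (a *: u) w = a * dotv u w.
Proof.
by rewrite /dotv mulr_sumr; apply: eq_bigr => i _; rewrite !mxE mulrA.
Qed.

Lemma dotvC n (u v : 'rV[R]_n) : dotv u v = dotv v u.
Proof. by apply: eq_bigr => i _; rewrite mulrC. Qed.

Lemma rat_vector_dense n (v : 'rV[R]_n) (e : R) : 0 < e ->
  exists q : 'rV[rat]_n, `|v - map_mx ratr q| < e.
Proof.
move=> e0.
have h i : exists q : rat, ratr q \in `]v 0 i - e / 2, v 0 i + e / 2[.
  by apply: rat_in_itvoo; rewrite ltrD2l; lra.
have [q qv] := choice h; exists (\row_i q i).
apply: (@le_lt_trans _ _ (e / 2)); last by lra.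
apply/row_norm_leP => [|i]; first by lra.
have := qv i; rewrite in_itv/= !mxE ler_norml => /andP[? ?].
by apply/andP; split; lra.
Qed.

(** The sigma-algebra is the product one, whereas openness refers to the norm of row vectors. An
    open set is the countable union of the cubes with rational centre and radius [1 / (k + 1)] that
    it contains, and a cube is a finite intersection of coordinate conditions. *)
Lemma open_measurable_tuple n (O : set 'rV[R]_n) :
  open O -> measurable (@rV_of_tuple R n @^-1` O).
Proof.
move=> oO.
pose B (x : 'rV[rat]_n * nat) : set (n.-tuple R) :=
  if `[< ball (map_mx ratr x.1 : 'rV[R]_n) (x.2.+1%:R^-1) `<=` O >] then
  [set t | forall i, `|ratr (x.1 0 i) - tnth t i| < x.2.+1%:R^-1] else set0.
have mB x : measurable (B x).
  rewrite /B; case: ifP => // _.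
  rewrite (_ : [set _ | _] = \big[setI/setT]_(i < n)
      ((fun t => ratr (x.1 0 i) - tnth t i) @^-1` (ball (0 : R) (x.2.+1%:R^-1) : set R))).
    apply: bigsetI_measurable => i _.
    rewrite -[X in measurable X]setTI; apply: measurable_funB => //.
    - exact: measurable_tnth.
    - exact: measurable_ball.
  rewrite -bigcap_seq; apply/seteqP; split => [t tq i _|t tq i].
    by rewrite /ball/= sub0r normrN; exact: tq.
  by have := tq i; rewrite /ball/= sub0r normrN; apply; rewrite mem_index_enum.
rewrite (_ : _ @^-1` _ = \bigcup_x B x).
  by apply: countable_bigcupT_measurable => //; exact: countableP.
apply/seteqP; split => [t|t [[q k] _]].
  move=> Ot; have /nbhs_ballP[e/= e0 eO] := open_nbhs_nbhs (conj oO Ot).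
  (* With radius below [e / 2] and centre within that radius of [t], the cube contains [t] and stays
     in the ball of radius [e]. *)
  have [k ke] : exists k : nat, k.+1%:R^-1 < e / 2.
    by have [|k] := @ltr_add_invr R 0 (e / 2); [rewrite divr_gt0|rewrite add0r; exists k].
  have k0 : 0 < k.+1%:R^-1 :> R by rewrite invr_gt0.
  have [q qt] := rat_vector_dense (rV_of_tuple t) k0.
  exists (q, k) => //; rewrite /B/= ifT; last first.
    apply/asboolP => v; rewrite mx_norm_ball/ball_/= => qv; apply: eO.
    rewrite mx_norm_ball/ball_/=.
    have -> : rV_of_tuple t - v = (rV_of_tuple t - map_mx ratr q) + (map_mx ratr q - v).
      by rewrite addrA subrK.
    apply: (le_lt_trans (ler_normD _ _)); apply: (lt_trans (ltrD qt qv)).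
    by rewrite [ltRHS]splitr ltrD.
  move=> i /=; apply: le_lt_trans qt.
  by have := coord_le_norm (rV_of_tuple t - map_mx ratr q) i; rewrite !mxE distrC.
rewrite /B/=; case: ifPn => // /asboolP qO h; apply: qO.
by split; [rewrite invr_gt0|move=> i j; rewrite !mxE !ord1/=; exact: h].
Qed.

Lemma closed_measurable_tuple n (A : set 'rV[R]_n) :
  closed A -> measurable (@rV_of_tuple R n @^-1` A).
Proof.
move=> cA; rewrite -[X in measurable X]setCK preimage_setC.
by apply: measurableC; apply: open_measurable_tuple; exact: closed_openC.
Qed.

Lemma continuous_measurable_tuple n (f : 'rV[R]_n -> R) :
  continuous f -> measurable_fun setT (f \o @rV_of_tuple R n).
Proof.
move=> /continuousP cf; apply: (measurability _ (RGenOpens.measurableE R)).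
move=> _ [_ [a [b ->] <-]]; rewrite setTI comp_preimage.
by apply: open_measurable_tuple; apply: cf; exact: interval_open.
Qed.

End vectors.

(** * Approximate differentiability *)

Lemma continuous_addr (R : realType) (V : normedModType R) (c : V) :
  continuous (fun v : V => v + c).
Proof. by move=> v; apply: cvgD; [exact: cvg_id|exact: cvg_cst]. Qed.

Lemma continuous_dist_affine (R : realType) (V : normedModType R) (f g : V -> R)
    (c : R) : continuous f -> continuous g ->
  continuous (fun v => `|g v - f v - c|).
Proof.
move=> cf cg v; apply: cvg_norm.
by apply: cvgB; [apply: cvgB; [exact: cg|exact: cf]|exact: cvg_cst].
Qed.

Section near_differentiability.
Context {R : realType} {p n : nat}.
Implicit Types (io : 'rV[R]_p -> 'rV[R]_n) (f : 'rV[R]_n -> R).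

(** [io] embeds the directions of increment: [id] for all of them, [cons_row 0] for those of the
    last coordinates. *)
Definition almost_affine io f (e : R) (d : 'rV[R]_p) (r : R) : set 'rV[R]_n :=
  [set v | forall h, `|h| < r -> `|f (v + io h) - f v - dotv d h| <= e * `|h|].

(** The slope may depend on [e], so that it can be taken rational; [nearly_diff_has_grad] recovers a
    single gradient when [io] is [id]. *)
Definition nearly_diff io f : set 'rV[R]_n :=
  [set v | forall e, 0 < e ->
    exists d, exists2 r, 0 < r & almost_affine io f e d r v].

Lemma almost_affine_weak io f e e' d d' r r' v :
  r' <= r -> e + p%:R * `|d - d'| <= e' ->
  almost_affine io f e d r v -> almost_affine io f e' d' r' v.
Proof.
move=> r'r ee' H h hr'.
have -> : f (v + io h) - f v - dotv d' h =
   (f (v + io h) - f v - dotv d h) + dotv (d - d') h by rewrite dotvBl; ring.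
apply: (le_trans (ler_normD _ _)).
apply: (@le_trans _ _ ((e + p%:R * `|d - d'|) * `|h|)); last exact: ler_wpM2r.
by rewrite mulrDl lerD ?dotv_le// H// (lt_le_trans hr').
Qed.

Lemma inv_succ_lt (e : R) : 0 < e -> exists k : nat, k.+1%:R^-1 < e.
Proof. by move=> /ltr_add_invr[k]; rewrite add0r; exists k. Qed.

Lemma nearly_diffP io f v : nearly_diff io f v <->
  forall j : nat, exists (q : 'rV[rat]_p) (k : nat),
    almost_affine io f j.+1%:R^-1 (map_mx ratr q) k.+1%:R^-1 v.
Proof.
split=> [H j|H e e0].
  have j0 : 0 < j.+1%:R^-1 / 2 :> R by rewrite divr_gt0// invr_gt0.
  have [d [r r0 Hd]] := H _ j0.
  have p0 : 0 < p%:R + 1 :> R by rewrite ltr_wpDl.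
  (* Half of the tolerance pays for the expansion, the other half for replacing [d] by a rational
     slope, which costs at most [p%:R] times their distance per unit of increment. *)
  have [q dq] := rat_vector_dense d (divr_gt0 j0 p0).
  have [k kr] := inv_succ_lt r0.
  exists q, k; apply: almost_affine_weak Hd; first exact: ltW.
  rewrite [leRHS]splitr lerD2l.
  apply: (@le_trans _ _ ((p%:R + 1) * `|d - map_mx ratr q|)).
    by rewrite ler_wpM2r// lerDl.
  by rewrite mulrC -ler_pdivlMr// ltW.
have [j je] := inv_succ_lt e0.
have [q [k Hqk]] := H j.
exists (map_mx ratr q), k.+1%:R^-1; first by rewrite invr_gt0.
apply: almost_affine_weak Hqk => //.
by rewrite subrr normr0 mulr0 addr0 ltW.
Qed.

(** For fixed [h] the inequality is closed in [v]. The intersection over [h] is uncountable, which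
    closedness survives but measurability might not. *)
Lemma closed_almost_affine io f e d r : continuous f ->
  closed (almost_affine io f e d r).
Proof.
move=> cf.
have -> : almost_affine io f e d r = \bigcap_(h in [set h | `|h| < r])
    (fun v => `|f (v + io h) - f v - dotv d h|) @^-1` [set x | x <= e * `|h|].
  by apply/seteqP; split => v Hv h hr; exact: Hv.
apply: closed_bigI => h hr; apply: preimage_closed; last exact: closed_le.
move=> v _; apply: continuous_dist_affine => //.
by move=> u; exact: (continuous_comp (@continuous_addr _ _ (io h) u) (cf _)).
Qed.

Lemma measurable_nearly_diff io f : continuous f ->
  measurable (@rV_of_tuple R n @^-1` nearly_diff io f).
Proof.
move=> cf.
have -> : @rV_of_tuple R n @^-1` nearly_diff io f = \bigcap_j \bigcup_q \bigcup_k
    (@rV_of_tuple R n @^-1`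
      almost_affine io f j.+1%:R^-1 (map_mx ratr (q : 'rV[rat]_p)) k.+1%:R^-1).
  apply/seteqP; split => t.
    move=> /= /nearly_diffP H j _; have [q [k Hk]] := H j.
    by exists q => //; exists k.
  move=> H; apply/nearly_diffP => j.
  by have [q _ [k _ Hk]] := H j Logic.I; exists q, k.
apply: bigcapT_measurable => j.
apply: countable_bigcupT_measurable => [|q]; first exact: countableP.
apply: bigcupT_measurable => k.
by apply: closed_measurable_tuple; exact: closed_almost_affine.
Qed.

End near_differentiability.

Section lipschitz.
Context {R : realType}.

Lemma lipschitz_continuous (V W : normedModType R) (f : V -> W) (L : R) :
  (forall u v, `|f u - f v| <= L * `|u - v|) -> continuous f.
Proof.
move=> fL x; apply/cvgrPdist_le => e e0.
have L0 : 0 < `|L| + 1 by rewrite ltr_wpDl.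
have d0 : 0 < e / (`|L| + 1) by rewrite divr_gt0.
near=> t; apply: (le_trans (fL _ _)).
apply: (@le_trans _ _ ((`|L| + 1) * `|x - t|)).
  by apply: ler_wpM2r => //; rewrite (le_trans (ler_norm L))// lerDl.
have xt : `|x - t| <= e / (`|L| + 1).
  by near: t; apply: cvgr_dist_le => //; exact: cvg_id.
by rewrite mulrC -ler_pdivlMr.
Unshelve. all: by end_near. Qed.

(** If no point of [A] were within [e * |h|] of [a + h], the ball of that radius about [a + h] would
    be missing from [A] inside the ball of radius [(1 + e) * |h|] about [a]. This leaves a
    proportion at most [1 / (1 + e)], which contradicts density 1 once [h] is small. *)
Lemma density_approx (A : set R) (a : R) : measurable A -> A a ->
  (lebesgue_measure (A `&` ball a r) * (lebesgue_measure (ball a r))^-1)%E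
     @[r --> 0^'+] --> (\1_A a)%:E ->
  forall e, 0 < e -> exists2 r, 0 < r &
    forall h, `|h| < r -> exists2 s, A s & `|s - (a + h)| <= e * `|h|.
Proof.
move=> mA Aa; rewrite indicE mem_set//= => dA e e0.
have e10 : 0 < 1 + e by lra.
have : \forall r \near (0:R)^'+, ((1 + e)^-1%:E <
    lebesgue_measure (A `&` ball a r) * (lebesgue_measure (ball a r))^-1)%E.
  apply: (dA [set x | ((1 + e)^-1%:E < x)%E]).
  apply: open_nbhs_nbhs; split; first exact: open_ereal_gt_ereal.
  by rewrite /= lte_fin invf_lt1//; lra.
move=> [r /= r0 Hr].
exists (r / (1 + e)); first by rewrite divr_gt0.
move=> h hr; have [->|h0] := eqVneq h 0.
  by exists a => //; rewrite addr0 subrr normr0 mulr0.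
apply: contrapT => noS.
have hpos : 0 < `|h| by rewrite normr_gt0.
pose rho := (1 + e) * `|h|.
have rho0 : 0 < rho by rewrite mulr_gt0.
have rhor : rho < r by rewrite /rho mulrC -ltr_pdivlMr.
have := Hr rho; rewrite /ball_/= sub0r normrN gtr0_norm// => /(_ rhor rho0).
rewrite ltNge => /negP; apply.
pose b := e * `|h|.
have b0 : 0 < b by rewrite mulr_gt0.
have sub : ball (a + h) b `<=` ball a rho.
  move=> s; rewrite /ball/= => hs.
  have -> : a - s = (a + h - s) - h by ring.
  rewrite (le_lt_trans (ler_normB _ _))// /rho mulrDl mul1r addrC ltrD2l.
  exact: hs.
have AS : A `&` ball a rho `<=` ball a rho `\` ball (a + h) b.
  move=> s [As sr]; split => // hs; apply: noS; exists s => //.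
  by rewrite distrC ltW.
have mle : (lebesgue_measure (A `&` ball a rho) <= (rho *+ 2 - b *+ 2)%:E)%E.
  apply: (@le_trans _ _ (lebesgue_measure (ball a rho `\` ball (a + h) b))).
    apply: le_measure; rewrite ?inE//.
    - by apply: measurableI => //; exact: measurable_ball.
    - by apply: measurableD; exact: measurable_ball.
  rewrite measureD; [|exact: measurable_ball|exact: measurable_ball|]; last first.
    by rewrite [X in (X < _)%E](lebesgue_measure_ball a (ltW rho0)) ltry.
  rewrite setIidr// [X in (X - _)%E](lebesgue_measure_ball a (ltW rho0)).
  by rewrite [X in (_ - X)%E](lebesgue_measure_ball (a + h) (ltW b0)).
have r2 : rho *+ 2 != 0 by rewrite mulrn_eq0/= gt_eqF.
rewrite (lebesgue_measure_ball a (ltW rho0)) inver (negbTE r2).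
apply: (@le_trans _ _ ((rho *+ 2 - b *+ 2)%:E * ((rho *+ 2)^-1)%:E)%E).
  by apply: lee_wpmul2r => //; rewrite lee_fin invr_ge0 mulrn_wge0// ltW.
have h0' : `|h| != 0 by rewrite gt_eqF.
have e1' : 1 + e != 0 by rewrite gt_eqF.
rewrite -EFinM lee_fin le_eqVlt; apply/orP; left; apply/eqP.
by rewrite /rho /b; field; rewrite h0' e1'.
Qed.

End lipschitz.

(** * Adding one coordinate *)

Section rademacher.
Context {R : realType}.

Definition cons_row n (a : R) (v : 'rV[R]_n) : 'rV[R]_n.+1 :=
  (row_mx a%:M v : 'rV_(1 + n)).

Lemma cons_rowD n (a b : R) (u v : 'rV[R]_n) :
  cons_row a u + cons_row b v = cons_row (a + b) (u + v).
Proof. by have := add_row_mx a%:M u b%:M v; rewrite -raddfD; exact. Qed.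

Lemma cons_row_surj n (h : 'rV[R]_n.+1) :
  exists a v, h = cons_row a v.
Proof.
exists (lsubmx (h : 'rV_(1 + n)) 0 0), (rsubmx (h : 'rV_(1 + n))).
by rewrite /cons_row -mx11_scalar hsubmxK.
Qed.

Lemma cons_rowEl n (a : R) (v : 'rV[R]_n) : cons_row a v 0 (@lshift 1 n 0) = a.
Proof. by apply: etrans (row_mxEl _ _ _ _) _; rewrite mxE. Qed.

Lemma cons_rowEr n (a : R) (v : 'rV[R]_n) i :
  cons_row a v 0 (@rshift 1 n i) = v 0 i.
Proof. exact: row_mxEr. Qed.

Lemma norm_cons_rowl n (a : R) (v : 'rV[R]_n) : `|a| <= `|cons_row a v|.
Proof. by have := coord_le_norm (cons_row a v) (@lshift 1 n 0); rewrite cons_rowEl. Qed.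

Lemma norm_cons_rowr n (a : R) (v : 'rV[R]_n) : `|v| <= `|cons_row a v|.
Proof.
apply/row_norm_leP => // i.
by have := coord_le_norm (cons_row a v) (@rshift 1 n i); rewrite cons_rowEr.
Qed.

Lemma norm_cons_row0 n (v : 'rV[R]_n) : `|cons_row 0 v| <= `|v|.
Proof.
apply/row_norm_leP => // i; rewrite /cons_row mxE.
by case: splitP => j _; rewrite ?coord_le_norm// mxE mul0rn normr0.
Qed.

Lemma norm_cons_0row n (a : R) : `|cons_row a (0 : 'rV[R]_n)| <= `|a|.
Proof.
apply/row_norm_leP => // i; rewrite /cons_row mxE.
by case: splitP => j _; rewrite mxE ?normr0// ord1 mulr1n.
Qed.

Lemma dotv_cons_row n (a b : R) (u v : 'rV[R]_n) :
  dotv (cons_row a u) (cons_row b v) = a * b + dotv u v.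
Proof.
rewrite /dotv (@big_split_ord _ _ _ 1 n) /= big_ord1.
rewrite !cons_rowEl; congr (_ + _).
by apply: eq_bigr => i _; rewrite !cons_rowEr.
Qed.

Lemma rV_of_tuple_cons n (a : R) (t : n.-tuple R) :
  rV_of_tuple (tcons (a, t)) = cons_row a (rV_of_tuple t).
Proof.
apply/rowP => i; rewrite /cons_row !mxE; case: splitP => j ij.
  rewrite !mxE ord1/= mulr1n; have -> : i = ord0.
    by apply/val_inj; move: ij; rewrite ord1.
  exact: tnth0.
rewrite !mxE; have -> : i = lift ord0 j by exact/val_inj.
exact: tnthS.
Qed.

Lemma derivable_near_affine (g : R -> R) (a : R) : derivable g a 1 ->
  forall e, 0 < e -> exists2 r, 0 < r &
    forall h, `|h| < r -> `|g (a + h) - g a - 'D_1 g a * h| <= e * `|h|.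
Proof.
move=> dg e e0; have := @cvgr_dist_le _ _ _ _ _ _ _ dg _ e0.
move=> [r /= r0 Hr]; exists r => // h hr.
have [->|h0] := eqVneq h 0; first by rewrite addr0 mulr0 subrr subr0 normr0 mulr0.
have := Hr h; rewrite /ball_/= sub0r normrN => /(_ hr h0).
rewrite -[lim _]/('D_1 g a) [h *: 1]mulr1 [h + a]addrC => H.
have -> : g (a + h) - g a - 'D_1 g a * h =
    - (('D_1 g a - h^-1 *: (g (a + h) - g a)) * h).
  by rewrite /GRing.scale/=; field.
by rewrite normrN normrM ler_wpM2r.
Qed.

(* Difference quotients of [f] at [cons_row a v] are compared through a nearby
   point [s] of the slice where [f (cons_row s _)] is almost affine at [v] with
   the same slope; density of the slice at [a] makes [s] available. *)
Lemma nearly_diff_cons n (f : 'rV[R]_n.+1 -> R) (L a : R) (v : 'rV[R]_n) :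
  (forall u w, `|f u - f w| <= L * `|u - w|) ->
  derivable (fun s => f (cons_row s v)) a 1 ->
  nearly_diff (cons_row 0) f (cons_row a v) ->
  (forall (j k : nat) (q : 'rV[rat]_n),
    let A := [set s : R | almost_affine (cons_row 0) f
       j.+1%:R^-1 (map_mx ratr q) k.+1%:R^-1 (cons_row s v)] in A a ->
    forall e, 0 < e -> exists2 r, 0 < r &
    forall h, `|h| < r -> exists2 s, A s & `|s - (a + h)| <= e * `|h|) ->
  nearly_diff id f (cons_row a v).
Proof.
move=> fL dera /nearly_diffP nd dens e e0.
have L0 : 0 < `|L| + 1 by rewrite ltr_wpDl.
have fL' u w : `|f u - f w| <= (`|L| + 1) * `|u - w|.
  by rewrite (le_trans (fL _ _))// ler_wpM2r// (le_trans (ler_norm L))// lerDl.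
(* Four error terms arise below, each at most [e / 4] times the norm of the increment. *)
have e4 : 0 < e / 4 by lra.
have [j je] := inv_succ_lt e4.
have [q [k Hq]] := nd j.
(* If [s] is within this multiple of [|b|] from [a + b], exchanging the two changes [f] by at most
   [e / 4 * |b|]. *)
have e' : 0 < e / 4 / (`|L| + 1) by rewrite divr_gt0.
have [r1 r10 Hr1] := dens j k q Hq _ e'.
have [r2 r20 Hr2] := derivable_near_affine dera e4.
set D := 'D_1 _ a in Hr2.
exists (cons_row D (map_mx ratr q)).
exists (Num.min k.+1%:R^-1 (Num.min r1 r2)).
  by rewrite !lt_min r10 r20 invr_gt0 ltr0n.
move=> h; have [b [w ->]] := cons_row_surj h.
rewrite !lt_min => /and3P[hk hr1 hr2].
have bh := norm_cons_rowl b w; have wh := norm_cons_rowr b w.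
have [s As sab] := Hr1 _ (le_lt_trans bh hr1).
have H1 := Hr2 _ (le_lt_trans bh hr2).
have H2 := As _ (le_lt_trans wh hk).
rewrite /= cons_rowD addr0 in H2.
have H3 u : `|f (cons_row (a + b) u) - f (cons_row s u)| <= e / 4 * `|b|.
  rewrite (le_trans (fL' _ _))//.
  have -> : cons_row (a + b) u - cons_row s u = cons_row (a + b - s) 0.
    by apply/eqP; rewrite subr_eq cons_rowD subrK add0r.
  rewrite mulrC -ler_pdivlMr// (le_trans (norm_cons_0row _ _))// distrC.
  by rewrite mulrAC.
rewrite cons_rowD dotv_cons_row.
(* The first coordinate [a + b] is exchanged for [s] at both [v + w] and [v]; between them the
   expansion on the slice at [s] applies, and the last term is the one-dimensional derivative at
   [a]. *)
have -> : f (cons_row (a + b) (v + w)) - f (cons_row a v) -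
    (D * b + dotv (map_mx ratr q) w) =
  (f (cons_row (a + b) (v + w)) - f (cons_row s (v + w))) +
  (f (cons_row s (v + w)) - f (cons_row s v) - dotv (map_mx ratr q) w) -
  (f (cons_row (a + b) v) - f (cons_row s v)) +
  (f (cons_row (a + b) v) - f (cons_row a v) - D * b) by ring.
have H2' : `|f (cons_row s (v + w)) - f (cons_row s v) - dotv (map_mx ratr q) w|
    <= e / 4 * `|cons_row b w|.
  apply: (le_trans H2); apply: (@le_trans _ _ (e / 4 * `|w|)).
    by rewrite ler_wpM2r// ltW.
  by rewrite ler_wpM2l// ltW.
have eb : e / 4 * `|b| <= e / 4 * `|cons_row b w| by rewrite ler_wpM2l// ltW.
have -> : e * `|cons_row b w| = e / 4 * `|cons_row b w| + e / 4 * `|cons_row b w|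
   + e / 4 * `|cons_row b w| + e / 4 * `|cons_row b w| by field.
rewrite (le_trans (ler_normD _ _))// lerD//; last exact: le_trans eb.
rewrite (le_trans (ler_normB _ _))// lerD//; last exact: le_trans eb.
by rewrite (le_trans (ler_normD _ _))// lerD//; exact: le_trans eb.
Qed.

End rademacher.

(** * Rademacher's theorem *)

Section null_sections.
Context d1 d2 (T1 : measurableType d1) (T2 : measurableType d2) (R : realType).
Variables (m1 : {sigma_finite_measure set T1 -> \bar R})
          (m2 : {sigma_finite_measure set T2 -> \bar R}).
Local Open Scope ereal_scope.

(** The product measure [\x] integrates the measures of [x]-sections; by uniqueness it equals [\x^],
    which integrates those of [y]-sections. A nonnegative function has zero integral exactly when it
    vanishes almost everywhere. *)
Lemma product_measure0_ysectionP (A : set (T1 * T2)) : measurable A ->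
  (m1 \x m2) A = 0 <-> {ae m2, forall t, m1 (ysection A t) = 0}.
Proof.
move=> mA.
have -> : (m1 \x m2) A = (m1 \x^ m2) A.
  by apply: product_measure_unique => // B C mB mC; exact: product_measure2E.
rewrite /product_measure2.
have mf : measurable_fun setT (m1 \o ysection A) by exact: measurable_fun_ysection.
rewrite (_ : (\int[m2]_x _)%E = \int[m2]_x `|(m1 \o ysection A) x|); last first.
  by apply: eq_integral => t _; rewrite gee0_abs.
split.
  move=> /(ae_eq_integral_abs m2 measurableT mf).
  by apply: filterS => t /(_ Logic.I).
move=> H; apply/(ae_eq_integral_abs m2 measurableT mf).
by apply: filterS H => t /= ->.
Qed.

End null_sections.

Section rademacher_tuple.
Context {R : realType}.

Lemma rademacher_tuple n (f : 'rV[R]_n -> R) (L : R) :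
  (forall u w, `|f u - f w| <= L * `|u - w|) ->
  lebesgue_tuple n (~` (@rV_of_tuple R n @^-1` nearly_diff id f)) = 0%E.
Proof.
elim: n f L => [|n IH] f L fL.
  rewrite (_ : ~` _ = set0) ?measure0//; apply/seteqP; split => // t.
  apply => e e0; exists 0, 1 => // h _.
  by rewrite (thinmx0 (_ + _)) (thinmx0 (rV_of_tuple t)) subrr sub0r normrN
    [X in `|X|]big_ord0 normr0 mulr_ge0// ltW.
have cf : continuous f := lipschitz_continuous fL.
have mT A : measurable A -> measurable (@tcons R n @^-1` A).
  by move=> mA; rewrite -[X in measurable X]setTI; exact: measurable_tcons.
pose B1 := @tcons R n @^-1` (~` (@rV_of_tuple R n.+1 @^-1` nearly_diff (cons_row 0) f)).
pose B := @tcons R n @^-1` (~` (@rV_of_tuple R n.+1 @^-1` nearly_diff id f)).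
have mB1 : measurable B1.
  by apply: mT; apply: measurableC; exact: (measurable_nearly_diff _ cf).
have mB : measurable B.
  by apply: mT; apply: measurableC; exact: (measurable_nearly_diff _ cf).
suff : (lebesgue_measure \x lebesgue_tuple n)%E B = 0%E by [].
(* For fixed [a] the section of [B1] is the exceptional set of the slice of [f] at [a], null by
   induction. *)
have B10 : (lebesgue_measure \x lebesgue_tuple n)%E B1 = 0%E.
  rewrite /product_measure1; apply: integral0_eq => a _ /=.
  have faL u w : `|f (cons_row a u) - f (cons_row a w)| <= `|L| * `|u - w|.
    rewrite (le_trans (fL _ _))//.
    have -> : cons_row a u - cons_row a w = cons_row 0 (u - w).
      by apply/eqP; rewrite subr_eq cons_rowD subrK add0r.
    rewrite (@le_trans _ _ (`|L| * `|cons_row 0 (u - w)|))//.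
      by rewrite ler_wpM2r// ler_norm.
    by rewrite ler_wpM2l// norm_cons_row0.
  rewrite -(IH _ _ faL); congr (lebesgue_tuple n _).
  apply/seteqP; split => t /=.
    move=> /xsectionP; rewrite /B1/= rV_of_tuple_cons; apply: contra_not.
    move=> H e e0; have [d [r r0 Hr]] := H e e0; exists d, r => // h hr.
    by rewrite cons_rowD addr0; exact: Hr.
  move=> nd; apply/xsectionP; move: nd; rewrite /B1/= rV_of_tuple_cons; apply: contra_not.
  move=> H e e0; have [d [r r0 Hr]] := H e e0; exists d, r => // h hr.
  by have := Hr h hr; rewrite cons_rowD addr0.
(* The order of integration is exchanged: [t] is now fixed and the first coordinate varies, as the
   one-dimensional theorems require. *)
apply: (product_measure0_ysectionP (@lebesgue_measure R) (lebesgue_tuple n) mB).2.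
move: ((product_measure0_ysectionP (@lebesgue_measure R) (lebesgue_tuple n) mB1).1 B10).
apply: filterS => t B1t.
have mBt : measurable (ysection B t) by exact: measurable_ysection.
apply/negligibleP => //.
set v := rV_of_tuple t.
have ndt : {ae lebesgue_measure, forall a, nearly_diff (cons_row 0) f (cons_row a v)}.
  exists (ysection B1 t); split => //; first exact: measurable_ysection.
  by move=> a /= nd; apply/ysectionP; rewrite /B1/= rV_of_tuple_cons.
have dert : {ae lebesgue_measure, forall a, derivable (fun s => f (cons_row s v)) a 1}.
  apply: (@lipschitz_ae_derivable _ _ `|L|) => s s'.
  rewrite (le_trans (fL _ _))//.
  have -> : cons_row s v - cons_row s' v = cons_row (s - s') 0.
    by apply/eqP; rewrite subr_eq cons_rowD subrK add0r.
  rewrite (@le_trans _ _ (`|L| * `|cons_row (s - s') (0 : 'rV_n)|))//.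
    by rewrite ler_wpM2r// ler_norm.
  by rewrite ler_wpM2l// norm_cons_0row.
pose A (x : nat * nat * 'rV[rat]_n) := [set s : R | almost_affine (cons_row 0) f
  x.1.1.+1%:R^-1 (map_mx ratr x.2) x.1.2.+1%:R^-1 (cons_row s v)].
have mA x : measurable (A x).
  rewrite (_ : A x = ysection (@tcons R n @^-1` (@rV_of_tuple R n.+1 @^-1`
    almost_affine (cons_row 0) f
      x.1.1.+1%:R^-1 (map_mx ratr x.2) x.1.2.+1%:R^-1)) t).
    apply: measurable_ysection; apply: mT.
    by apply: closed_measurable_tuple; exact: closed_almost_affine.
  apply/seteqP; split => s.
    by move=> As; apply/ysectionP; rewrite /= rV_of_tuple_cons.
  by move=> /ysectionP; rewrite /= rV_of_tuple_cons.
(* [unpickle] enumerates the triples of tolerance, radius and rational slope, so that a single null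
   set serves all the sets [A x]. *)
have dent : {ae lebesgue_measure, forall a, forall k : nat,
    if unpickle k is Some x then
    (lebesgue_measure (A x `&` ball a r) * (lebesgue_measure (ball a r))^-1)%E
     @[r --> 0^'+] --> (\1_(A x) a)%:E else True}.
  apply: ae_foralln => k.
  case: (unpickle k) => [x|]; last exact: aeW.
  exact: lebesgue_density.
have FF := ae_filter_ringOfSetsType (@lebesgue_measure R).
have [C [mC C0 CB]] := @filterI _ _ FF _ _ ndt (@filterI _ _ FF _ _ dert dent).
exists C; split => // a /ysectionP; rewrite /B/= rV_of_tuple_cons => nd.
apply: CB => -[nda [dera dena]]; apply: nd.
apply: nearly_diff_cons fL dera nda _ => j k q /= Aa.
apply: density_approx => //; first exact: (mA (j, k, q)).
by have := dena (pickle (j, k, q)); rewrite pickleK.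
Qed.

End rademacher_tuple.

(** * Gradients and Jacobians *)

Section first_order_expansion.
Context {R : realType} {V W : normedModType R}.
Implicit Types (f : V -> W) (df : V -> W) (x : V).

Definition first_order f df x := forall e, 0 < e -> exists2 r, 0 < r &
  forall h, `|h| < r -> `|f (x + h) - f x - df h| <= e * `|h|.

Lemma first_order_diff f (df : {linear V -> W}) x : continuous df ->
  first_order f df x -> differentiable f x /\ 'd f x = df :> (V -> W).
Proof.
move=> cdf fdf.
have fo : f \o shift x = cst (f x) + df +o_ 0 id.
  apply/eqaddoP => e e0; have [r r0 Hr] := fdf _ e0.
  apply/nbhs_ballP; exists r => // h; rewrite -ball_normE/= sub0r normrN => hr.
  by have := Hr h hr; rewrite [x + h]addrC -addrA -opprD.
have ddf := diff_unique cdf fo; split => //.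
by apply/diff_locallyP; rewrite ddf.
Qed.

End first_order_expansion.

Section jacobian.
Context {R : realType}.

Lemma mulmx_norm n m (h : 'rV[R]_n) (A : 'M[R]_(n, m)) :
  `|h *m A| <= n%:R * `|A| * `|h|.
Proof.
apply/row_norm_leP => [|j]; first by rewrite !mulr_ge0.
have -> : (h *m A) 0 j = dotv (\row_i A i j) h.
  by rewrite mxE; apply: eq_bigr => i _; rewrite mxE mulrC.
rewrite (le_trans (dotv_le _ _))// ler_wpM2r// ler_wpM2l//.
apply/row_norm_leP => // i; rewrite mxE.
by rewrite {2}/Num.norm/= mx_normrE; exact: (le_bigmax _ _ (i, j)).
Qed.

Lemma continuous_mulmxr n m (A : 'M[R]_(n, m)) :
  continuous (fun h : 'rV[R]_n => h *m A).
Proof.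
apply: (@lipschitz_continuous R _ _ _ (n%:R * `|A|)) => u v.
by rewrite -mulmxBl mulmx_norm.
Qed.

Definition has_jac n m (F : 'rV[R]_n -> 'rV[R]_m) (x : 'rV[R]_n)
  (J : 'M[R]_(m, n)) := first_order F (fun h => h *m J^T) x.

Lemma has_jacP n m (F : 'rV[R]_n -> 'rV[R]_m) x J :
  has_jac F x J -> differentiable F x /\ Jac F x = J.
Proof.
move=> FJ; have [dF dFE] := first_order_diff (df := mulmxr J^T)
  (@continuous_mulmxr _ _ J^T) FJ; split => //.
apply: trmx_inj; rewrite trmxK; apply/row_matrixP => i.
by rewrite !rowE /jacobian mul_rV_lin1 dFE.
Qed.

Definition has_grad n (f : 'rV[R]_n -> R) (x : 'rV[R]_n) (d : 'rV[R]_n) :=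
  first_order f (fun h => dotv d h) x.

Lemma linear_dotv n (f : {linear 'rV[R]_n -> R}) (h : 'rV[R]_n) :
  f h = dotv (\row_j f (delta_mx 0 j)) h.
Proof.
rewrite [in LHS](row_sum_delta h) linear_sum/=; apply: eq_bigr => j _.
by rewrite linearZ/= mxE mulrC.
Qed.

Lemma has_jac_coord n m (F : 'rV[R]_n -> 'rV[R]_m) x J : has_jac F x J <->
  forall i, has_grad (fun u => F u 0 i) x (row i J).
Proof.
have E i h : (F (x + h) - F x - h *m J^T) 0 i =
    F (x + h) 0 i - F x 0 i - dotv (row i J) h.
  rewrite !mxE; congr (_ - _); apply: eq_bigr => j _.
  by rewrite !mxE mulrC.
split=> [FJ i e e0|FJ e e0].
  have [r r0 Hr] := FJ e e0; exists r => // h hr.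
  by rewrite -E (le_trans (coord_le_norm _ _))// Hr.
have /choice[r rP] i : exists r, 0 < r /\ forall h, `|h| < r ->
    `|F (x + h) 0 i - F x 0 i - dotv (row i J) h| <= e * `|h|.
  by have [r r0 Hr] := FJ i e e0; exists r.
exists (\big[Num.min/1]_i r i); first by apply/bigmin_gtP; split => // i _; have [] := rP i.
move=> h /bigmin_gtP[_ hr]; apply/row_norm_leP => [|i]; first by rewrite mulr_ge0// ltW.
by rewrite E; apply: (rP i).2; exact: hr.
Qed.

End jacobian.

Section rademacher_gradient.
Context {R : realType}.

Lemma dotv_delta n (d : 'rV[R]_n) (t : R) j :
  dotv d (t *: delta_mx 0 j) = t * d 0 j.
Proof.
rewrite /dotv (bigD1 j)//= big1 => [|i ij]; rewrite !mxE eqxx/=.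
  by rewrite eqxx mulr1 addr0 mulrC.
by rewrite (negbTE ij) !mulr0.
Qed.

Lemma norm_delta n j : `|delta_mx 0 j : 'rV[R]_n| <= 1.
Proof.
apply/row_norm_leP => // i; rewrite mxE eqxx /=.
by case: (i == j); rewrite ?normr1 ?normr0.
Qed.

(** Both expansions are tested on the same increment [t *: delta_mx 0 j], with [t] below both radii,
    and their difference is divided by [t]. *)
Lemma almost_affine_coord n (f : 'rV[R]_n -> R) v e1 e2 d1 d2 r1 r2 j :
  0 < r1 -> 0 < r2 -> 0 <= e1 -> 0 <= e2 ->
  almost_affine id f e1 d1 r1 v -> almost_affine id f e2 d2 r2 v ->
  d1 0 j - d2 0 j <= e1 + e2.
Proof.
move=> r10 r20 e10 e20 H1 H2.
pose t := Num.min r1 r2 / 2.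
have m0 : 0 < Num.min r1 r2 by rewrite lt_min r10.
have t0 : 0 < t by rewrite divr_gt0.
pose h : 'rV[R]_n := t *: delta_mx 0 j.
have ht : `|h| <= t.
  by rewrite normrZ gtr0_norm// ger_pMr// norm_delta.
have /andP[t1 t2] : (t < r1) && (t < r2).
  by rewrite -lt_min /t ltr_pdivrMr// ltr_pMr// ltr1n.
have := H1 h (le_lt_trans ht t1); rewrite ler_norml => /andP[+ _].
have := H2 h (le_lt_trans ht t2); rewrite ler_norml => /andP[_].
rewrite /= !dotv_delta => h1 h2.
have h3 : e1 * `|h| <= e1 * t by rewrite ler_wpM2l.
have h4 : e2 * `|h| <= e2 * t by rewrite ler_wpM2l.
rewrite -(ler_pM2l t0) mulrBr mulrDr.
by move: h1 h2 h3 h4; rewrite ![t * e1]mulrC ![t * e2]mulrC; lra.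
Qed.

Lemma nearly_diff_has_grad n (f : 'rV[R]_n -> R) v :
  nearly_diff id f v -> exists d, has_grad f v d.
Proof.
move=> nd.
have kpos k : 0 < k.+1%:R^-1 :> R by rewrite invr_gt0.
have /choice[p pP] k : exists p : 'rV[R]_n * R, 0 < p.2 /\
    almost_affine id f k.+1%:R^-1 p.1 p.2 v.
  by have [d [r r0 H]] := nd _ (kpos k); exists (d, r).
pose d k := (p k).1.
have dd k l j : d k 0 j - d l 0 j <= k.+1%:R^-1 + l.+1%:R^-1.
  have [rk Hk] := pP k; have [rl Hl] := pP l.
  exact: almost_affine_coord rk rl (ltW (kpos k)) (ltW (kpos l)) Hk Hl.
(* Every [d k 0 j - 1 / (k + 1)] lies below every [d l 0 j + 1 / (l + 1)]. The supremum of the lower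
   family separates the two, hence is within [1 / (k + 1)] of each [d k 0 j]. *)
pose S j : set R := range (fun k => d k 0 j - k.+1%:R^-1).
have Sub j l : ubound (S j) (d l 0 j + l.+1%:R^-1).
  by move=> _ [k _ <-]; rewrite lerBlDr -addrA -lerBlDl [leRHS]addrC dd.
have Ssup j : has_sup (S j).
  by split; [exists (d 0%N 0 j - 1%:R^-1), 0%N|exists (d 0%N 0 j + 1%:R^-1)].
pose D : 'rV[R]_n := \row_j sup (S j).
have dD k : `|d k - D| <= k.+1%:R^-1.
  apply/row_norm_leP => [|j]; first exact: ltW.
  rewrite !mxE ler_norml.
  have h1 : sup (S j) <= d k 0 j + k.+1%:R^-1 by apply: ge_sup => //; case: (Ssup j).
  have h2 : d k 0 j - k.+1%:R^-1 <= sup (S j).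
    by apply: ub_le_sup; [case: (Ssup j)|exists k].
  by apply/andP; split; [rewrite lerBrDl lerBlDr|rewrite lerBlDr -lerBlDl].
exists D => e e0.
have n0 : 0 < n%:R + 1 :> R by rewrite ltr_wpDl.
have [k ke] := inv_succ_lt (divr_gt0 e0 n0).
have [rk Hk] := pP k; exists (p k).2 => //.
apply: almost_affine_weak Hk => //.
rewrite (@le_trans _ _ ((n%:R + 1) * k.+1%:R^-1))//; last first.
  by rewrite mulrC -ler_pdivlMr// ltW.
by rewrite mulrDl mul1r [leRHS]addrC lerD2l ler_wpM2l//; exact: dD.
Qed.

End rademacher_gradient.

(** * The uniform measure on the ball *)

Section integral_full_set.
Context d (T : measurableType d) (R : realType).
Variable mu : {measure set T -> \bar R}.
Local Open Scope ereal_scope.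
Import HBNNSimple.

(* The point is that [f] need not be measurable. *)
Lemma integral_full_set (D : set T) (f : T -> \bar R) :
  measurable D -> mu (~` D) = 0 -> \int[mu]_x f x = \int[mu]_(x in D) f x.
Proof.
move=> mD D0.
have ge0 (g : T -> \bar R) : (forall x, 0 <= g x) ->
    \int[mu]_x g x = \int[mu]_(x in D) g x.
  move=> g0; rewrite ge0_integralTE// ge0_integralE//.
  apply/eqP; rewrite eq_le; apply/andP; split; apply: ge_ereal_sup => _ [h /= hg <-].
    (* Simple functions are measurable even when [g] is not: one below [g] is cut off by the
       indicator of [D], which changes it only on the null complement of [D]. *)
    apply: ereal_sup_ubound; exists (proj_nnsfun h mD) => /=.
      move=> x; rewrite /patch mindicE; case: ifPn => xD /=.
        by rewrite mulr1; exact: hg.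
      by rewrite mulr0.
    have hE (k : {nnsfun T >-> R}) : sintegral mu k = \int[mu]_x (k x)%:E.
      by rewrite integralT_nnsfun.
    rewrite !hE; apply: ge0_ae_eq_integral;
      [by []|exact/measurable_EFinP/measurable_funPT|
       exact/measurable_EFinP/measurable_funPT|
       by move=> x _; rewrite lee_fin|by move=> x _; rewrite lee_fin|].
    exists (~` D); split => //; first exact: measurableC.
    move=> x /= H; apply: contra_not H => xD _.
    by rewrite mindicE mem_set//= mulr1.
  apply: ereal_sup_ubound; exists h => //= x.
  apply: (le_trans (hg x)); rewrite /patch; case: ifPn => // _; exact: g0.
by rewrite integralE [RHS]integralE !ge0.
Qed.

End integral_full_set.

Section uniform_ball_facts.
Context {R : realType}.

Definition tuple_box n (c : R) : set (n.-tuple R) :=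
  [set t | forall i, `|tnth t i| <= c].

Lemma measurable_tuple_box n c : measurable (@tuple_box n c).
Proof.
rewrite (_ : tuple_box _ = \big[setI/setT]_(i < n)
    ((fun t : n.-tuple R => tnth t i) @^-1` `[- c, c]%classic)).
  apply: bigsetI_measurable => i _.
  rewrite -[X in measurable X]setTI; apply: measurable_tnth => //.
rewrite -bigcap_seq; apply/seteqP; split => [t H i _|t H i].
  by rewrite /= in_itv/= -ler_norml H.
by have := H i; rewrite /= in_itv/= -ler_norml; apply; rewrite mem_index_enum.
Qed.

Lemma lebesgue_tuple_box n (c : R) : 0 <= c ->
  lebesgue_tuple n (tuple_box c) = ((c *+ 2) ^+ n)%:E.
Proof.
move=> c0; elim: n => [|n IH].
  rewrite /= expr0 diracE mem_set//; last by move=> [].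
rewrite [LHS](_ : _ = (lebesgue_measure \x lebesgue_tuple n)%E
    (`[- c, c]%classic `*` tuple_box c)); last first.
  congr ((lebesgue_measure \x lebesgue_tuple n)%E _).
  apply/seteqP; split => -[a t] /=.
    move=> H; split.
      by rewrite /= in_itv/= -ler_norml; have := H ord0; rewrite tnth0.
    by move=> i; have := H (lift ord0 i); rewrite tnthS.
  move=> [/=]; rewrite in_itv/= -ler_norml => ac H i.
  by case: (unliftP ord0 i) => [j ->|->]; rewrite ?tnthS ?tnth0.
rewrite product_measure1E//; last exact: measurable_tuple_box.
rewrite [X in (_ * X)%E]IH exprS EFinM; congr (_ * _)%E.
apply: (etrans (lebesgue_measure_itv `[- c, c])); rewrite /= lte_fin.
case: ltP => cc; first by rewrite -EFinD opprK mulr2n.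
by congr EFin; rewrite mulr2n; lra.
Qed.

Lemma dotv_ge0 n (v : 'rV[R]_n) : 0 <= dotv v v.
Proof. by apply: sumr_ge0 => i _; rewrite -expr2 sqr_ge0. Qed.

Lemma norm_le_enorm n (v : 'rV[R]_n) : `|v| <= enorm v.
Proof.
apply/row_norm_leP => [|i]; first exact: sqrtr_ge0.
rewrite -sqrtr_sqr ler_sqrt ?dotv_ge0// /dotv (bigD1 i)//= -expr2 lerDl.
by apply: sumr_ge0 => j _; rewrite -expr2 sqr_ge0.
Qed.

Lemma enorm_le_norm n (v : 'rV[R]_n) : enorm v <= n%:R * `|v|.
Proof.
rewrite -[leRHS]ger0_norm ?mulr_ge0// -sqrtr_sqr ler_sqrt ?sqr_ge0//.
apply: (@le_trans _ _ (n%:R * `|v| ^+ 2)).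
  rewrite /dotv mulr_natl -[X in _ *+ X]card_ord -sumr_const; apply: ler_sum => i _.
  by rewrite -expr2 -real_normK ?num_real// lerXn2r ?nnegrE// coord_le_norm.
rewrite exprMn ler_wpM2r ?sqr_ge0// expr2 -natrM ler_nat.
by case: n {v} => // n; rewrite leq_pmulr.
Qed.

(** The ball lies between the cubes of half-sides [1 / (n + 1)] and [1]; hence [uniform_ball] never
    takes the default value of [mnormalize]. *)
Lemma tuple_ball_measure n : (0 < lebesgue_tuple n (@tuple_ball R n) < +oo)%E.
Proof.
apply/andP; split.
  have c0 : 0 < n.+1%:R^-1 :> R by rewrite invr_gt0.
  apply: (@lt_le_trans _ _ (lebesgue_tuple n (tuple_box n.+1%:R^-1))).
    by rewrite lebesgue_tuple_box ?ltW// lte_fin exprn_gt0// pmulrn_lgt0.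
  apply: le_measure; rewrite ?inE; [exact: measurable_tuple_box|
    exact: measurable_tuple_ball|].
  move=> t H; rewrite /tuple_ball/=; apply: (le_trans (enorm_le_norm _)).
  apply: (@le_trans _ _ (n%:R * n.+1%:R^-1)); last first.
    by rewrite ler_pdivrMr ?ltr0n// mul1r ler_nat.
  by rewrite ler_wpM2l//; apply/row_norm_leP => [|i]; [exact: ltW|rewrite mxE].
apply: (@le_lt_trans _ _ (lebesgue_tuple n (tuple_box 1))).
  apply: le_measure; rewrite ?inE; [exact: measurable_tuple_ball|
    exact: measurable_tuple_box|].
  move=> t; rewrite /tuple_ball/= => tb i.
  have := coord_le_norm (rV_of_tuple t) i; rewrite mxE => /le_trans; apply.
  exact: le_trans (norm_le_enorm _) tb.
by rewrite lebesgue_tuple_box// ltry.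
Qed.

Lemma uniform_ballE n (A : set (n.-tuple R)) : uniform_ball n A =
  (lebesgue_tuple n (A `&` @tuple_ball R n) *
   ((fine (lebesgue_tuple n (@tuple_ball R n)))^-1)%:E)%E.
Proof.
have /andP[b0 boo] := tuple_ball_measure n.
have bT : lebesgue_tuple n (setT `&` @tuple_ball R n) =
  lebesgue_tuple n (@tuple_ball R n) by rewrite setTI.
rewrite /uniform_ball /= /mnormalize; case: ifPn => [/orP[]/eqP b|_].
- by move: b0; rewrite -bT [X in (_ < X)%E](b : _ = 0%E) ltxx.
- by move: boo; rewrite -bT [X in (X < _)%E](b : _ = +oo%E) ltxx.
by rewrite -bT.
Qed.

Lemma uniform_ball_setC n : uniform_ball n (~` @tuple_ball R n) = 0%E.
Proof. by rewrite uniform_ballE setICl measure0 mul0e. Qed.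

Lemma ae_uniform_ball n (Q : set (n.-tuple R)) :
  {ae lebesgue_tuple n, forall t, Q t} -> {ae @uniform_ball R n, forall t, Q t}.
Proof.
move=> [A [mA A0 QA]]; exists A; split => //.
rewrite [LHS]uniform_ballE (_ : lebesgue_tuple n _ = 0%E) ?mul0e//.
apply/eqP; rewrite eq_le measure_ge0 andbT -A0 le_measure ?inE//.
by apply: measurableI => //; exact: measurable_tuple_ball.
Qed.

End uniform_ball_facts.

(** * Differentiating a mean *)

Section bounded_integrals.
Context d (T : measurableType d) (R : realType) (P : probability T R).
Variables (D : set T) (mD : measurable D).

Lemma bounded_integrable (g : T -> R) (M : R) :
  measurable_fun D g -> (forall t, D t -> `|g t| <= M) ->
  P.-integrable D (EFin \o g).
Proof.
move=> mg gM; apply: measurable_bounded_integrable => //.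
  by rewrite (le_lt_trans (probability_le1 P mD)) ?ltry.
exists M; split; first exact: num_real.
by move=> N MN t Dt; exact: le_trans (gM t Dt) (ltW MN).
Qed.

Lemma Rintegral_sum (I : Type) (s : seq I) (g : I -> T -> R) :
  (forall i, P.-integrable D (EFin \o g i)) ->
  \int[P]_(t in D) (\sum_(i <- s) g i t) = \sum_(i <- s) \int[P]_(t in D) g i t.
Proof.
move=> ig; elim: s => [|i s IH].
  rewrite big_nil; under eq_Rintegral do rewrite big_nil.
  by rewrite Rintegral_cst// mul0r.
rewrite big_cons -IH; under eq_Rintegral do rewrite big_cons.
rewrite RintegralD//.
have -> : (EFin \o (fun t => \sum_(j <- s) g j t)) =
    (fun t => (\sum_(j <- s) (EFin \o g j) t)%E).
  by apply/funext => t; rewrite /= sumEFin.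
exact: integrable_sum.
Qed.

End bounded_integrals.

Section mean_gradient.
Context {R : realType} {n : nat}.
Variables (f : 'rV[R]_n -> R) (L : R).
Hypothesis fL : forall u w, `|f u - f w| <= L * `|u - w|.
Local Notation P := (@uniform_ball R n).
Local Notation B := (@tuple_ball R n).
Local Notation W := (@rV_of_tuple R n).

Definition quotient (i : 'I_n) (k : nat) (v : 'rV[R]_n) : R :=
  k.+1%:R * (f (v + k.+1%:R^-1 *: delta_mx 0 i) - f v).

Lemma has_grad_quotient v d i : has_grad f v d ->
  quotient i ^~ v @ \oo --> d 0 i.
Proof.
move=> fd; apply/cvgrPdist_le => e e0.
have [r r0 Hr] := fd e e0.
have [K _ HK] := near_infty_natSinv_lt (PosNum r0).
exists K => // k /HK /= kr.
have k0 : 0 < k.+1%:R^-1 :> R by rewrite invr_gt0.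
pose h : 'rV[R]_n := k.+1%:R^-1 *: delta_mx 0 i.
have hk : `|h| <= k.+1%:R^-1.
  by rewrite normrZ gtr0_norm// ger_pMr// norm_delta.
have := Hr h (le_lt_trans hk kr); rewrite dotv_delta => H.
rewrite -(ler_pM2l k0) /quotient distrC.
rewrite -[X in X * `|_|](gtr0_norm k0) -normrM mulrBr mulrA mulVf ?pnatr_eq0// mul1r.
by rewrite (le_trans H)// mulrC ler_wpM2r// ltW.
Qed.

Lemma continuous_quotient i k : continuous (quotient i k).
Proof.
apply: (@lipschitz_continuous R _ _ _ (k.+1%:R * (`|L| + `|L|))) => u v.
rewrite -mulrBr normrM ger0_norm// -mulrA ler_wpM2l//.
have H a b : `|f a - f b| <= `|L| * `|a - b|.
  by rewrite (le_trans (fL _ _))// ler_wpM2r// ler_norm.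
set h := _ *: _.
have -> : f (u + h) - f u - (f (v + h) - f v) =
  (f (u + h) - f (v + h)) - (f u - f v) by ring.
rewrite (le_trans (ler_normB _ _))// mulrDl lerD//.
by rewrite (le_trans (H _ _))// opprD addrACA subrr addr0.
Qed.

Lemma quotient_le i k v : `|quotient i k v| <= `|L|.
Proof.
rewrite /quotient normrM ger0_norm// mulrC -ler_pdivlMr// (le_trans (fL _ _))//.
rewrite (@le_trans _ _ (`|L| * `|k.+1%:R^-1 *: delta_mx 0 i : 'rV[R]_n|))//.
  by rewrite [X in `|X|]addrC addKr ler_wpM2r// ler_norm.
rewrite ler_wpM2l// normrZ ger0_norm// ger_pMr ?invr_gt0//; exact: norm_delta.
Qed.

Lemma has_grad_coord_le v d i : has_grad f v d -> `|d 0 i| <= `|L|.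
Proof.
move=> /(has_grad_quotient (i := i)) H.
have /cvg_norm {}H := H.
apply: (closed_cvg (fun x => x <= `|L|) _ _ _ H); first exact: closed_le.
by apply: nearW => k; exact: quotient_le.
Qed.

(* On the null set where the quotients diverge, truncation keeps the candidate
   gradient bounded. *)
Definition sup_gradient (t : n.-tuple R) : 'rV[R]_n :=
  \row_i Num.max (- `|L|) (Num.min `|L|
    (fine (limn_esup (fun k => (quotient i k (W t))%:E)))).

Lemma measurable_sup_gradient i : measurable_fun setT (fun t => sup_gradient t 0 i).
Proof.
rewrite (_ : (fun _ => _) = (fun t => Num.max (- `|L|) (Num.min `|L|
    (fine (limn_esup (fun k => (quotient i k (W t))%:E)))))); last first.
  by apply/funext => t; rewrite mxE.
apply: measurable_maxr => //; apply: measurable_minr => //.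
apply: measurableT_comp => //; apply: measurable_fun_limn_esup => k.
apply/measurable_EFinP; apply: continuous_measurable_tuple.
exact: continuous_quotient.
Qed.

Lemma sup_gradient_le t : `|sup_gradient t| <= `|L|.
Proof.
apply/row_norm_leP => // i; rewrite mxE ler_norml le_max lexx/=.
by rewrite ge_max ge_min lexx /= andbT (le_trans _ (normr_ge0 L))// oppr_le0.
Qed.

(** At a point with a gradient, the quotients converge to its coordinates, which are bounded by
    [|L|], so that the limit superior is the limit and the truncation is inactive. Rademacher's
    theorem says that almost all points are such. *)
Lemma ae_sup_gradient : {ae P, forall t, has_grad f (W t) (sup_gradient t)}.
Proof.
apply: ae_uniform_ball.
have [A [mA A0 fA]] : (lebesgue_tuple n).-negligible (~` (W @^-1` nearly_diff id f)).
  exists (~` (W @^-1` nearly_diff id f)); split => //.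
    apply: measurableC; apply: measurable_nearly_diff.
    exact: lipschitz_continuous fL.
  exact: rademacher_tuple fL.
exists A; split => // t ngt; apply: fA => /nearly_diff_has_grad[d fd]; apply: ngt => /=.
rewrite (_ : sup_gradient t = d)//; apply/rowP => i; rewrite mxE.
have := has_grad_quotient (i := i) fd.
move=> qd; have {}qd : (fun k => (quotient i k (W t))%:E) @ \oo --> (d 0 i)%:E.
  by apply/cvg_EFin => //; exact: nearW.
rewrite (cvg_limn_einf_sup qd).2 /=.
have := has_grad_coord_le i fd; rewrite ler_norml => /andP[h1 h2].
by rewrite (min_idPr h2) (max_idPr h1).
Qed.

Let fL' u w : `|f u - f w| <= `|L| * `|u - w|.
Proof. by rewrite (le_trans (fL _ _))// ler_wpM2r// ler_norm. Qed.

Let mB : measurable B. Proof. exact: measurable_tuple_ball. Qed.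

Let WB t : B t -> `|W t| <= 1.
Proof. exact/le_trans/norm_le_enorm. Qed.

Lemma measurable_shift h : measurable_fun setT (fun t => f (W t + h)).
Proof.
apply: (@continuous_measurable_tuple R n (fun v => f (v + h))).
apply: (@lipschitz_continuous R _ _ _ L) => u v.
by rewrite (le_trans (fL _ _))// opprD addrACA subrr addr0.
Qed.

Lemma integrable_shift h : P.-integrable B (EFin \o (fun t => f (W t + h))).
Proof.
apply: (@bounded_integrable _ _ _ _ _ mB _ (`|f 0| + `|L| * (1 + `|h|))).
  by apply: measurable_funTS; exact: measurable_shift.
move=> t /WB tB; rewrite -[f _](subrK (f 0)) addrC (le_trans (ler_normD _ _))// lerD2l.
rewrite (le_trans (fL' _ _))// subr0 ler_wpM2l// (le_trans (ler_normD _ _))//.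
by rewrite lerD2r.
Qed.

Lemma integrable_sup_gradient i : P.-integrable B (EFin \o (fun t => sup_gradient t 0 i)).
Proof.
apply: (@bounded_integrable _ _ _ _ _ mB _ `|L|).
  by apply: measurable_funTS; exact: measurable_sup_gradient.
by move=> t _; rewrite (le_trans (coord_le_norm _ _))// sup_gradient_le.
Qed.

Definition mean_gradient : 'rV[R]_n :=
  \row_i \int[P]_(t in B) sup_gradient t 0 i.

Lemma integrable_dotv h : P.-integrable B (EFin \o (fun t => dotv (sup_gradient t) h)).
Proof.
have -> : EFin \o (fun t => dotv (sup_gradient t) h) =
    (fun t => (\sum_(i < n) (h 0%R i)%:E * (EFin \o (fun t => sup_gradient t 0%R i)) t)%E).
  apply/funext => t; rewrite /= /dotv -sumEFin; apply: eq_bigr => i _.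
  by rewrite mulrC EFinM.
apply: integrable_sum => // i _.
by apply: integrableZl => //; exact: integrable_sup_gradient.
Qed.

Lemma dotv_mean_gradient h :
  dotv mean_gradient h = \int[P]_(t in B) dotv (sup_gradient t) h.
Proof.
rewrite /dotv Rintegral_sum//; last first.
  move=> i; rewrite (_ : _ \o _ =
    (fun t => ((h 0%R i)%:E * (EFin \o (fun t => sup_gradient t 0%R i)) t)%E)); last first.
    by apply/funext => t /=; rewrite mulrC EFinM.
  by apply: integrableZl => //; exact: integrable_sup_gradient.
by apply: eq_bigr => i _; rewrite mxE -RintegralZr//; exact: integrable_sup_gradient.
Qed.

(** Differentiation under the integral sign, by contradiction: a violation at tolerance [e] yields
    increments [h k] tending to 0 along which the normalized remainders [psi k] have mean above [e],
    although they are uniformly bounded and tend to 0 almost everywhere. *)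
Lemma has_grad_mean :
  has_grad (fun h => \int[P]_(t in B) f (W t + h)) 0 mean_gradient.
Proof.
move=> e e0; apply: contrapT => noR.
have /choice[h hP] k : exists h : 'rV[R]_n, `|h| < k.+1%:R^-1 /\
    e * `|h| < `|\int[P]_(t in B) f (W t + (0 + h)) -
      \int[P]_(t in B) f (W t + 0) - dotv mean_gradient h|.
  apply: contrapT => noh; apply: noR; exists k.+1%:R^-1; first by rewrite invr_gt0.
  move=> h hk; rewrite leNgt; apply/negP => eh; apply: noh; by exists h.
have h0 k : 0 < `|h k|.
  rewrite normr_gt0; apply/eqP => hk0; have := (hP k).2.
  rewrite hk0 addr0 subrr sub0r normrN normr0 mulr0 /dotv big1 ?normr0 ?ltxx//.
  by move=> i _; rewrite [X in _ * X]mxE mulr0.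
pose D t k := f (W t + h k) - f (W t + 0) - dotv (sup_gradient t) (h k).
pose psi k t := `|h k|^-1 * `|D t k|.
have mD k : measurable_fun setT (D ^~ k).
  apply: measurable_funB.
    by apply: measurable_funB; exact: measurable_shift.
  apply: measurable_sum => i; apply: measurable_funM => //.
  exact: measurable_sup_gradient.
have mpsi k : measurable_fun setT (psi k).
  by apply: measurable_funM => //; exact: measurableT_comp.
have Dle t k : `|D t k| <= (`|L| + n%:R * `|L|) * `|h k|.
  rewrite (le_trans (ler_normB _ _))// mulrDl lerD//.
    by rewrite (le_trans (fL' _ _))// addr0 addrAC subrr add0r.
  by rewrite (le_trans (dotv_le _ _))// ler_wpM2r// ler_wpM2l// sup_gradient_le.
have psile t k : `|psi k t| <= `|L| + n%:R * `|L|.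
  rewrite normrM normr_id ger0_norm ?invr_ge0// mulrC ler_pdivrMr//; exact: Dle.
have iD k : P.-integrable B (EFin \o (D ^~ k)).
  apply: (@bounded_integrable _ _ _ _ _ mB _ ((`|L| + n%:R * `|L|) * `|h k|)) => //.
  by apply: measurable_funTS.
have ipsi k : P.-integrable B (EFin \o psi k).
  apply: (@bounded_integrable _ _ _ _ _ mB _ (`|L| + n%:R * `|L|)) => //.
  by apply: measurable_funTS.
have psi_cvg : {ae P, forall t, B t -> (EFin \o psi k) t @[k --> \oo] --> (0 : \bar R)}.
  apply: filterS ae_sup_gradient => t gt _.
  apply/fine_cvgP; split; first exact: nearW.
  apply/cvgrPdist_le => a a0; have [r r0 Hr] := gt a a0.
  have [K _ HK] := near_infty_natSinv_lt (PosNum r0).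
  exists K => // k /HK /= kr.
  have := Hr _ (lt_trans (hP k).1 kr).
  rewrite sub0r normrN /psi normrM normr_id ger0_norm ?invr_ge0// => H.
  by rewrite mulrC ler_pdivrMr// /D addr0.
have [_ _] := @dominated_convergence _ _ _ P B mB (fun k => EFin \o psi k) (cst 0%E)
  (cst (`|L| + n%:R * `|L|)%:E)
  (fun k => measurable_int _ (ipsi k)) (measurable_cst _) psi_cvg
  (@bounded_integrable _ _ _ P _ mB (cst (`|L| + n%:R * `|L|)) `|(`|L| + n%:R * `|L|)|
     (measurable_cst _) (fun t _ => lexx _))
  (aeW _ (fun t k _ => psile t k)).
rewrite integral0 => /fine_cvgP[_ /cvgrPdist_lt/(_ e e0)[K _ /(_ K (leqnn K))/=]].
rewrite sub0r normrN => H.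
have := (hP K).2; apply/negP; rewrite -leNgt.
have -> : \int[P]_(t in B) f (W t + (0 + h K)) -
      \int[P]_(t in B) f (W t + 0) - dotv mean_gradient (h K) =
      \int[P]_(t in B) D t K.
  rewrite add0r dotv_mean_gradient /D RintegralB//; last exact: integrable_dotv.
    by rewrite RintegralB//; exact: integrable_shift.
  have -> : EFin \o (fun t => f (W t + h K) - f (W t + 0)) =
      ((EFin \o (fun t => f (W t + h K)%R)) \- (EFin \o (fun t => f (W t + 0)%R)))%E.
    by apply/funext => t.
  by apply: integrableB => //; exact: integrable_shift.
apply: (le_trans (le_normr_Rintegral mB (iD K))).
rewrite mulrC -ler_pdivrMl// -RintegralZl//; last first.
  have -> : EFin \o (fun t => `|D t K|) = abse \o (EFin \o (D ^~ K)) by [].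
  exact: integrable_abse.
exact: le_trans (ler_norm _) (ltW H).
Qed.

End mean_gradient.

(** * Means and convex sets *)

Section mean_jacobian.
Context {R : realType} {n m : nat}.
Local Notation P := (@uniform_ball R n).
Local Notation B := (@tuple_ball R n).
Local Notation W := (@rV_of_tuple R n).

Lemma mean_jacobian (z : 'rV[R]_n -> 'rV[R]_m) (L : R) :
  (forall u w, `|z u - z w| <= L * `|u - w|) ->
  exists J : n.-tuple R -> 'M[R]_(m, n),
  [/\ forall i j, measurable_fun setT (fun t => J t i j),
      forall t i j, `|J t i j| <= `|L|,
      {ae P, forall t, has_jac z (W t) (J t)} &
      has_jac (fun h => \row_i \int[P]_(t in B) z (W t + h) 0 i) 0
        (\matrix_(i, j) \int[P]_(t in B) J t i j)].
Proof.
move=> zL.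
pose f i u := z u 0 i.
have fL i u w : `|f i u - f i w| <= L * `|u - w|.
  rewrite (le_trans _ (zL u w))//; have := coord_le_norm (z u - z w) i.
  by rewrite !mxE.
exists (fun t => \matrix_(i, j) sup_gradient (f i) L t 0 j); split.
- move=> i j; under eq_fun do rewrite mxE.
  exact: (measurable_sup_gradient (fL i)).
- move=> t i j; rewrite mxE (le_trans (coord_le_norm _ _))//.
  exact: sup_gradient_le.
(* The finitely many rows are indexed by [nat] through [insub], so that [ae_foralln] intersects
   their full-measure sets. *)
- have : {ae P, forall t, forall i : nat, if insub i is Some i then
      has_grad (f i) (W t) (sup_gradient (f i) L t) else True}.
    apply: ae_foralln => k; case: insubP => [i _ _|_]; last exact: aeW.
    exact: ae_sup_gradient.
  apply: filterS => t tP; apply/has_jac_coord => i.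
  have := tP i; rewrite valK.
  by congr (has_grad _ _ _); apply/rowP => j; rewrite !mxE.
apply/has_jac_coord => i.
have -> : (fun u => (\row_i0 \int[P]_(t in B) z (W t + u) 0 i0) 0 i) =
    (fun u => \int[P]_(t in B) f i (W t + u)).
  by apply/funext => u; rewrite mxE.
have -> : row i (\matrix_(i, j) \int[P]_(t in B)
    (\matrix_(i, j) sup_gradient (f i) L t 0 j) i j) = mean_gradient (f i) L.
  by apply/rowP => j; rewrite !mxE; apply: eq_Rintegral => t _; rewrite mxE.
exact: (has_grad_mean (fL i)).
Qed.

End mean_jacobian.

Lemma convex_setP (R : realType) (V : lmodType R) (C : set V) :
  @convex_set R V C <-> forall v w l, C v -> C w -> 0 <= l -> l <= 1 ->
    C (l *: v + (1 - l) *: w).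
Proof.
split=> H v w l.
  move=> Cv Cw l0 l1; apply/set_mem.
  by have := H v w (Itv01 l0 l1) (mem_set Cv) (mem_set Cw).
by move=> /set_mem Cv /set_mem Cw; apply/mem_set; exact: H.
Qed.

Section mean_convex.
Context d (T : measurableType d) (R : realType) (P : probability T R).
Variables (D : set T) (mD : measurable D) (PD : P D = 1%E).
Variables (m n : nat) (J : T -> 'M[R]_(m, n)) (L : R).
Hypothesis mJ : forall i j, measurable_fun setT (fun t => J t i j).
Hypothesis JL : forall t i j, `|J t i j| <= L.

Let M : 'M[R]_(m, n) := \matrix_(i, j) \int[P]_(t in D) J t i j.

Let iJ i j : P.-integrable D (EFin \o (fun t => J t i j)).
Proof.
by apply: (@bounded_integrable _ _ _ _ _ mD _ L) => //; exact: measurable_funTS.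
Qed.

Lemma ae_le_Rintegral (g : T -> R) (c : R) : P.-integrable D (EFin \o g) ->
  {ae P, forall t, D t -> g t <= c} -> \int[P]_(t in D) g t <= c.
Proof.
move=> ig gc.
have mg : measurable_fun D g by apply/measurable_EFinP; exact: measurable_int ig.
(* [le_Rintegral] compares functions at every point of [D], hence this truncation, which agrees with
   [g] almost everywhere. *)
pose h t := Num.min (g t) c.
have mh : measurable_fun D h by exact: measurable_minr.
have gh : \int[P]_(t in D) g t = \int[P]_(t in D) h t.
  congr fine; apply: ae_eq_integral => //; try exact/measurable_EFinP.
  apply: filterS gc => t gt Dt; congr EFin.
  by rewrite /h (min_idPl (gt Dt)).
have ih : P.-integrable D (EFin \o h).
  apply: le_integrable (integrableD mD (integrable_abse ig)
    (@bounded_integrable _ _ _ P _ mD (cst `|c|) `|c| (measurable_cst _) _)) => //.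
  - exact/measurable_EFinP.
  - move=> t Dt; rewrite /= lee_fin.
    apply: (@le_trans _ _ (`|g t| + `|c|)); last exact: ler_norm.
    by rewrite /h minEle; case: ifP => _; rewrite ?lerDl ?lerDr.
  - by move=> t _ /=; rewrite normr_id.
rewrite gh.
have -> : c = \int[P]_(t in D) c by rewrite Rintegral_cst// [X in fine X]PD mulr1.
apply: le_Rintegral => //.
  by apply: (@bounded_integrable _ _ _ _ _ mD _ `|c|).
by move=> t _; rewrite /h ge_min lexx orbT.
Qed.

(** A linear functional commutes with the mean, so a half-space containing almost all [J t] contains
    [M]. *)
Lemma ae_linear_le (a : 'M[R]_(m, n)) (c : R) :
  {ae P, forall t, D t -> \sum_ij a ij.1 ij.2 * J t ij.1 ij.2 <= c} ->
  \sum_ij a ij.1 ij.2 * M ij.1 ij.2 <= c.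
Proof.
move=> H.
have iaJ ij : P.-integrable D (EFin \o (fun t => a ij.1 ij.2 * J t ij.1 ij.2)).
  apply: (@bounded_integrable _ _ _ _ _ mD _ (`|a ij.1 ij.2| * L)).
    by apply: measurable_funM => //; exact: measurable_funTS.
  by move=> t _; rewrite normrM ler_wpM2l.
have -> : \sum_ij a ij.1 ij.2 * M ij.1 ij.2 =
    \int[P]_(t in D) \sum_ij a ij.1 ij.2 * J t ij.1 ij.2.
  rewrite Rintegral_sum//; apply: eq_bigr => ij _.
  by rewrite mxE RintegralZl.
apply: ae_le_Rintegral => //.
have -> : (EFin \o (fun t => \sum_ij a ij.1 ij.2 * J t ij.1 ij.2)) =
    (fun t => (\sum_ij (EFin \o (fun t => a ij.1 ij.2 * J t ij.1 ij.2)%R) t)%E).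
  by apply/funext => t; rewrite /= sumEFin.
exact: integrable_sum.
Qed.

(** Squared Frobenius distance: it comes from an inner product, so it is a quadratic polynomial
    along a segment. *)
Definition sqdist (V W : 'M[R]_(m, n)) : R := \sum_ij (V ij.1 ij.2 - W ij.1 ij.2) ^+ 2.

Lemma sqdist_ge0 V W : 0 <= sqdist V W.
Proof. by apply: sumr_ge0 => ij _; exact: sqr_ge0. Qed.

(* A point of [C] nearly closest to the mean [M]: were it at positive distance,
   moving it towards a typical [J t] would bring it closer. *)
Lemma mean_convex_approx (C : set 'M[R]_(m, n)) : convex_set C ->
  {ae P, forall t, D t -> C (J t)} ->
  forall e, 0 < e -> exists2 V, C V & sqdist M V < e.
Proof.
move=> convC CJ e e0.
(* Otherwise [D], of measure 1, would lie in a null set. *)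
have [t0 [Dt0 Ct0]] : exists t, D t /\ C (J t).
  apply: contrapT => noC; have [A [mA A0 CA]] := CJ.
  have : (P D <= P A)%E.
    apply: le_measure; rewrite ?inE// => t Dt; apply: CA => /= H; apply: noC.
    by exists t; split => //; exact: H.
  by rewrite PD A0 lee_fin ler10.
pose S := [set sqdist M V | V in C].
have S0 : has_inf S.
  split; first by exists (sqdist M (J t0)), (J t0).
  by exists 0 => _ [V _ <-]; exact: sqdist_ge0.
pose rho := inf S.
have rhoP V : C V -> rho <= sqdist M V.
  by move=> CV; apply: ge_inf; [case: S0|exists V].
suff rho0 : rho <= 0.
  have [_ [V CV <-] HV] := inf_adherent e0 S0.
  exists V => //; rewrite (lt_le_trans HV)// -/rho.
  by rewrite gerDr.
(* Bound for [sqdist (J t) V]: entrywise, [(J - V)^2 <= 2 (J - M)^2 + 2 (M - V)^2], where [J - M] is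
   at most [2 * L] in absolute value and [sqdist M V] is at most [rho + 1]. *)
pose K := \sum_(ij : 'I_m * 'I_n) (8 * L ^+ 2) + 2 * (rho + 1).
have rho_ge0 : 0 <= rho by apply: lb_le_inf; [case: S0|move=> _ [V _ <-]; exact: sqdist_ge0].
have ML i j : `|M i j| <= L.
  rewrite mxE (le_trans (le_normr_Rintegral mD _))//.
  apply: ae_le_Rintegral; last by apply: aeW => t _; exact: JL.
  exact: (integrable_abse (iJ i j)).
suff H l : 0 < l -> l <= 1 -> rho <= l * ((1 + K) / 2).
  rewrite leNgt; apply/negP => rho0.
  have K0 : 0 < 1 + K.
    rewrite /K; have : 0 <= \sum_(ij : 'I_m * 'I_n) (8 * L ^+ 2).
      by apply: sumr_ge0 => ij _; rewrite mulr_ge0// sqr_ge0.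
    by lra.
  (* This choice makes the right-hand side of [H] at most [rho / 2]. *)
  pose l := Num.min 1 (rho / (1 + K)).
  have l0 : 0 < l by rewrite lt_min ltr01 divr_gt0.
  have l1 : l <= 1 by rewrite ge_min lexx.
  have Hl := H l l0 l1.
  have : l * (1 + K) <= rho.
    by rewrite -ler_pdivlMr// ge_min lexx orbT.
  by rewrite leNgt => /negP; apply; move: Hl; lra.
move=> l0 l1.
have l20 : 0 < l ^+ 2 by rewrite exprn_gt0.
(* [V] is optimal up to [l ^+ 2], the order of the quadratic term of a step of length [l]; after
   division by [2 * l] the error is of order [l]. *)
have [_ [V CV <-] HV] := inf_adherent l20 S0; rewrite -/rho in HV.
apply: (le_trans (rhoP V CV)).
pose a := M - V.
(* [c] bounds the inner product of [a] with almost every [J t], hence with [M]; subtracting the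
   inner product of [a] with [V] leaves [sqdist M V]. *)
pose c := (l * (1 + K)) / 2 + \sum_ij a ij.1 ij.2 * V ij.1 ij.2.
have : \sum_ij a ij.1 ij.2 * M ij.1 ij.2 <= c.
  apply: ae_linear_le; apply: filterS CJ => t CJt Dt.
  have Ct := CJt Dt.
  have CW : C (V + l *: (J t - V)).
    have -> : V + l *: (J t - V) = l *: J t + (1 - l) *: V.
      by rewrite scalerBr scalerBl scale1r addrCA addrA.
    exact: (convex_setP C).1 convC _ _ _ Ct CV (ltW l0) l1.
  have := rhoP _ CW.
  have -> : sqdist M (V + l *: (J t - V)) = sqdist M V
     - 2 * l * \sum_ij a ij.1 ij.2 * (J t ij.1 ij.2 - V ij.1 ij.2) + l ^+ 2 * sqdist (J t) V.
    rewrite /sqdist !mulr_sumr -sumrN -!big_split/=; apply: eq_bigr => ij _.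
    by rewrite !mxE; ring.
  have dK : sqdist (J t) V <= K.
    apply: (@le_trans _ _ (\sum_(ij : 'I_m * 'I_n) (8 * L ^+ 2) + 2 * sqdist M V)).
      rewrite /sqdist mulr_sumr -big_split/=; apply: ler_sum => -[i j] _ /=.
      have := ML i j; have := JL t i j; rewrite !ler_norml => /andP[? ?] /andP[? ?].
      have h1 : (J t i j - M i j) ^+ 2 <= 4 * L ^+ 2.
        rewrite -subr_ge0.
        have -> : 4 * L ^+ 2 - (J t i j - M i j) ^+ 2 =
          (2 * L - (J t i j - M i j)) * (2 * L + (J t i j - M i j)) by ring.
        by apply: mulr_ge0; lra.
      have h2 := sqr_ge0 (J t i j - M i j - (M i j - V i j)).
      rewrite -subr_ge0; rewrite -subr_ge0 in h1.
      have -> : 8 * L ^+ 2 + 2 * (M i j - V i j) ^+ 2 - (J t i j - V i j) ^+ 2 =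
        2 * (4 * L ^+ 2 - (J t i j - M i j) ^+ 2) +
        (J t i j - M i j - (M i j - V i j)) ^+ 2 by ring.
      by rewrite addr_ge0// mulr_ge0.
    rewrite /K lerD2l ler_pM2l// (le_trans (ltW HV))// lerD2l.
    by rewrite expr_le1// ltW.
  have -> : \sum_ij a ij.1 ij.2 * (J t ij.1 ij.2 - V ij.1 ij.2) =
    \sum_ij a ij.1 ij.2 * J t ij.1 ij.2 - \sum_ij a ij.1 ij.2 * V ij.1 ij.2.
    by rewrite -sumrB; apply: eq_bigr => ij _; rewrite mulrBr.
  rewrite /c.
  set A1 := \sum_ij a ij.1 ij.2 * J t ij.1 ij.2.
  set A2 := \sum_ij a ij.1 ij.2 * V ij.1 ij.2 => H.
  have lK : l ^+ 2 * sqdist (J t) V <= l ^+ 2 * K by rewrite ler_pM2l.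
  have l2 : 0 < 2 * l by rewrite mulr_gt0.
  rewrite -lerBlDr -(ler_pM2l l2).
  have -> : 2 * l * (l * (1 + K) / 2) = l ^+ 2 + l ^+ 2 * K by field.
  by move: H HV lK; lra.
have -> : sqdist M V = \sum_ij a ij.1 ij.2 * M ij.1 ij.2 - \sum_ij a ij.1 ij.2 * V ij.1 ij.2.
  rewrite /sqdist -sumrB; apply: eq_bigr => ij _.
  by rewrite -mulrBr /a !mxE expr2.
by rewrite /c mulrA lerBlDr.
Qed.

End mean_convex.

(** * Euclidean norms *)

Section euclidean_norms.
Context {R : realType}.

Lemma enorm_ge0 n (v : 'rV[R]_n) : 0 <= enorm v. Proof. exact: sqrtr_ge0. Qed.

Lemma enorm_sq n (v : 'rV[R]_n) : enorm v ^+ 2 = dotv v v.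
Proof. by rewrite sqr_sqrtr// dotv_ge0. Qed.

Lemma dotvDr n (u v w : 'rV[R]_n) : dotv u (v + w) = dotv u v + dotv u w.
Proof. by rewrite dotvC dotvDl ![dotv _ u]dotvC. Qed.

Lemma dotvZr n (a : R) (u w : 'rV[R]_n) : dotv u (a *: w) = a * dotv u w.
Proof. by rewrite dotvC dotvZl dotvC. Qed.

Lemma dotvNr n (u w : 'rV[R]_n) : dotv u (- w) = - dotv u w.
Proof. by rewrite dotvC dotvNl dotvC. Qed.

Lemma enormZ n (a : R) (v : 'rV[R]_n) : enorm (a *: v) = `|a| * enorm v.
Proof.
by rewrite /enorm dotvZl dotvZr mulrA -expr2 sqrtrM ?sqr_ge0// sqrtr_sqr.
Qed.

Lemma enorm0 n : enorm (0 : 'rV[R]_n) = 0.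
Proof. by rewrite -(scale0r 0) enormZ normr0 mul0r. Qed.

Lemma enorm_eq0 n (v : 'rV[R]_n) : enorm v = 0 -> v = 0.
Proof.
by move=> v0; apply/eqP; rewrite -normr_le0; have := norm_le_enorm v; rewrite v0.
Qed.

Lemma cauchy_schwarz n (u v : 'rV[R]_n) : dotv u v <= enorm u * enorm v.
Proof.
have [v0|vn0] := eqVneq (enorm v) 0.
  rewrite v0 mulr0 (enorm_eq0 v0) /dotv big1// => i _.
  by rewrite [X in _ * X]mxE mulr0.
have v_gt0 : 0 < enorm v by rewrite lt_neqAle eq_sym vn0 enorm_ge0.
have [u0|un0] := eqVneq (enorm u) 0.
  rewrite u0 mul0r (enorm_eq0 u0) /dotv big1// => i _.
  by rewrite [X in X * _]mxE mul0r.
have u_gt0 : 0 < enorm u by rewrite lt_neqAle eq_sym un0 enorm_ge0.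
have := dotv_ge0 (enorm v *: u - enorm u *: v).
rewrite !(dotvDl, dotvDr, dotvNl, dotvNr, dotvZl, dotvZr) -!enorm_sq [dotv v u]dotvC.
set a := enorm u; set b := enorm v; set c := dotv u v.
have -> : b * (b * a ^+ 2 - a * c) + (b * - (a * c) - a * - (a * b ^+ 2)) =
  2 * (a * b) * (a * b - c) by ring.
by rewrite pmulr_rge0 ?subr_ge0// !mulr_gt0.
Qed.

Lemma enormD n (u v : 'rV[R]_n) : enorm (u + v) <= enorm u + enorm v.
Proof.
rewrite -(@ler_pXn2r _ 2)// ?nnegrE ?addr_ge0 ?enorm_ge0//.
rewrite enorm_sq dotvDl !dotvDr -!enorm_sq [dotv v u]dotvC.
have := cauchy_schwarz u v; rewrite sqrrD mulr2n; lra.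
Qed.

Lemma enorm_mul_bounded m n (V : 'M[R]_(m, n)) (v : 'rV[R]_n) :
  enorm (v *m V^T) <= m%:R * (n%:R * `|V^T|) * enorm v.
Proof.
apply: (le_trans (enorm_le_norm _)); rewrite -mulrA ler_wpM2l//.
by rewrite (le_trans (mulmx_norm _ _))// ler_wpM2l ?mulr_ge0// norm_le_enorm.
Qed.

Lemma opnorm_has_sup m n (V : 'M[R]_(m, n)) :
  has_sup [set enorm (v *m V^T) | v in closed_eball (0 : 'rV[R]_n) 1].
Proof.
split.
  by exists (enorm ((0 : 'rV[R]_n) *m V^T)), 0 => //; rewrite /closed_eball/= subr0 enorm0.
exists (m%:R * (n%:R * `|V^T|) * 1) => _ [v v1 <-].
rewrite (le_trans (enorm_mul_bounded _ _))// ler_wpM2l ?mulr_ge0//.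
by move: v1; rewrite /closed_eball/= subr0.
Qed.

Lemma opnorm_ge m n (V : 'M[R]_(m, n)) (v : 'rV[R]_n) :
  enorm v <= 1 -> enorm (v *m V^T) <= opnorm V.
Proof.
move=> v1; apply: ub_le_sup; first by case: (opnorm_has_sup V).
by exists v => //; rewrite /closed_eball/= subr0.
Qed.

Lemma opnorm_le m n (V : 'M[R]_(m, n)) (c : R) :
  (forall v, enorm v <= 1 -> enorm (v *m V^T) <= c) -> opnorm V <= c.
Proof.
move=> Vc; apply: ge_sup; first by case: (opnorm_has_sup V).
by move=> _ [v v1 <-]; apply: Vc; move: v1; rewrite /closed_eball/= subr0.
Qed.

Lemma opnorm_ge0 m n (V : 'M[R]_(m, n)) : 0 <= opnorm V.
Proof.
apply: le_trans (enorm_ge0 (0 *m V^T)) _; apply: opnorm_ge.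
by rewrite enorm0 ler01.
Qed.

Lemma opnorm_bound m n (V : 'M[R]_(m, n)) (v : 'rV[R]_n) :
  enorm (v *m V^T) <= opnorm V * enorm v.
Proof.
have [v0|vn0] := eqVneq (enorm v) 0.
  by rewrite (enorm_eq0 v0) mul0mx !enorm0 mulr0.
have v_gt0 : 0 < enorm v by rewrite lt_neqAle eq_sym vn0 enorm_ge0.
have := @opnorm_ge _ _ V ((enorm v)^-1 *: v).
rewrite enormZ ger0_norm ?invr_ge0 ?enorm_ge0// mulVf// => /(_ (lexx _)).
rewrite -scalemxAl enormZ ger0_norm ?invr_ge0 ?enorm_ge0//.
by rewrite ler_pdivrMl// mulrC.
Qed.

Lemma opnormD m n (V W : 'M[R]_(m, n)) : opnorm (V + W) <= opnorm V + opnorm W.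
Proof.
apply: opnorm_le => v v1; rewrite linearD/= mulmxDr (le_trans (enormD _ _))//.
by rewrite lerD// opnorm_ge.
Qed.

Lemma opnormZ_le m n (a : R) (V : 'M[R]_(m, n)) : 0 <= a ->
  opnorm (a *: V) <= a * opnorm V.
Proof.
move=> a0; apply: opnorm_le => v v1; rewrite linearZ/= -scalemxAr enormZ ger0_norm//.
by rewrite ler_wpM2l// opnorm_ge.
Qed.

(** A crude constant is enough: it multiplies an error that can be made arbitrarily small. *)
Lemma opnorm_le_sqdist m n (V W : 'M[R]_(m, n)) :
  opnorm (V - W) <= m%:R * n%:R * Num.sqrt (sqdist V W).
Proof.
apply: opnorm_le => v v1; apply: (le_trans (enorm_mul_bounded _ _)).
rewrite mulrA -[leRHS]mulr1 ler_pM ?mulr_ge0// ?enorm_ge0// ler_wpM2l//.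
rewrite [X in X <= _]/Num.norm/= mx_normrE; apply/bigmax_leP; split => //.
move=> [j i] _ /=; rewrite !mxE -sqrtr_sqr ler_sqrt ?sqdist_ge0//.
rewrite /sqdist (bigD1 (i, j))//= lerDl.
by apply: sumr_ge0 => ij _; exact: sqr_ge0.
Qed.

Lemma dotv_mulmx m n (d : 'rV[R]_m) (V : 'M[R]_(m, n)) (w : 'rV[R]_n) :
  dotv (d *m V) w = dotv d (w *m V^T).
Proof.
have E k (a b : 'rV[R]_k) : dotv a b = (a *m b^T) 0 0.
  by rewrite mxE; apply: eq_bigr => i _; rewrite mxE.
by rewrite !E trmx_mul trmxK mulmxA.
Qed.

Lemma mxdist_ge0 m n (V : 'M[R]_(m, n)) S : (0 <= mxdist V S)%E.
Proof. by apply: le_ereal_inf_tmp => _ [W _ <-]; rewrite lee_fin opnorm_ge0. Qed.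

(** The infimum may not be attained on [S], hence the slack [e]. *)
Lemma mxdist_lt m n (V : 'M[R]_(m, n)) S (w : R) : (mxdist V S <= w%:E)%E ->
  forall e, 0 < e -> exists2 W, S W & opnorm (V - W) < w + e.
Proof.
move=> Vw e e0; have : (mxdist V S < (w + e)%:E)%E.
  by rewrite (le_lt_trans Vw)// lte_fin ltrDl.
by move=> /ereal_inf_lt[_ [W SW <-]]; rewrite lte_fin; exists W.
Qed.

Lemma mxdist_leP m n (V : 'M[R]_(m, n)) S (w : R) :
  (forall e, 0 < e -> exists2 W, S W & opnorm (V - W) <= w + e) ->
  (mxdist V S <= w%:E)%E.
Proof.
move=> H; apply/lee_addgt0Pr => e /H[W SW VW].
apply: (@le_trans _ _ (opnorm (V - W))%:E); first by apply: ereal_inf_lbound; exists W.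
by rewrite -EFinD lee_fin.
Qed.

(** Near-optimal elements for [V1] and [V2] are combined with the same weights. Thus a neighbourhood
    of fixed width of a Clarke Jacobian is a convex set to which [mean_convex_approx] applies. *)
Lemma convex_mxdist m n (S : set 'M[R]_(m, n)) (w : R) :
  @convex_set R 'M[R]_(m, n) S ->
  @convex_set R 'M[R]_(m, n) [set V | (mxdist V S <= w%:E)%E].
Proof.
move=> /convex_setP cS; apply/convex_setP => V1 V2 l H1 H2 l0 l1.
apply: mxdist_leP => e e0.
have [W1 SW1 VW1] := mxdist_lt H1 e0; have [W2 SW2 VW2] := mxdist_lt H2 e0.
exists (l *: W1 + (1 - l) *: W2); first exact: cS.
have -> : l *: V1 + (1 - l) *: V2 - (l *: W1 + (1 - l) *: W2) =
    l *: (V1 - W1) + (1 - l) *: (V2 - W2) by rewrite opprD addrACA -!scalerBr.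
have l1' : 0 <= 1 - l by rewrite subr_ge0.
rewrite (le_trans (opnormD _ _))//.
have -> : w + e = l * (w + e) + (1 - l) * (w + e) by ring.
by rewrite lerD// (le_trans (opnormZ_le _ _))// ler_wpM2l// ltW.
Qed.

End euclidean_norms.

(** * Lipschitz extension *)

Section lipschitz_extension.
Context {R : realType}.

Lemma mcshane_extension (V : normedModType R) (K : set V) (g : V -> R) (L : R) :
  0 <= L -> K !=set0 -> (forall u v, K u -> K v -> `|g u - g v| <= L * `|u - v|) ->
  exists G : V -> R, (forall u, K u -> G u = g u) /\
    forall u v, `|G u - G v| <= L * `|u - v|.
Proof.
move=> L0 [s0 Ks0] gL.
(* McShane's formula: the infimum over [s] of the cones [g s + L * |u - s|], bounded below by the
   inverted cone at [s0]. *)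
pose S u := [set g s + L * `|u - s| | s in K].
have Slb u : lbound (S u) (g s0 - L * `|u - s0|).
  move=> _ [s Ks <-]; have := gL s0 s Ks0 Ks; rewrite ler_norml => /andP[_ h1].
  have h2 : `|s0 - s| <= `|u - s0| + `|u - s|.
    by rewrite -[s0 - s](subrKA u) (le_trans (ler_normD _ _))// [`|s0 - u|]distrC.
  have := ler_wpM2l L0 h2; rewrite mulrDr; lra.
have Sinf u : has_inf (S u).
  by split; [exists (g s0 + L * `|u - s0|), s0|exists (g s0 - L * `|u - s0|)].
have Sle u s : K s -> inf (S u) <= g s + L * `|u - s|.
  by move=> Ks; apply: ge_inf; [case: (Sinf u)|exists s].
exists (fun u => inf (S u)); split.
  move=> u Ku; apply/eqP; rewrite eq_le; apply/andP; split.
    by have := Sle u u Ku; rewrite subrr normr0 mulr0 addr0.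
  apply: lb_le_inf; first by case: (Sinf u).
  move=> _ [s Ks <-]; have := gL u s Ku Ks; rewrite ler_norml => /andP[_].
  lra.
have half u v : inf (S u) <= inf (S v) + L * `|u - v|.
  rewrite -lerBlDr; apply: lb_le_inf; first by case: (Sinf v).
  move=> _ [s Ks <-]; have := Sle u s Ks.
  have h2 : `|u - s| <= `|u - v| + `|v - s|.
    by rewrite -[u - s](subrKA v) ler_normD.
  have := ler_wpM2l L0 h2; rewrite mulrDr; lra.
move=> u v; rewrite ler_norml; apply/andP; split.
  by have := half v u; rewrite [`|v - u|]distrC; lra.
by have := half u v; lra.
Qed.

(** Near a diagonal point the local constant works; near [(p, q)] with [p] and [q] distinct, local
    bounds on [F] are divided by a positive distance. Compactness of the square of [K] makes one
    constant serve all pairs. *)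
Lemma compact_lipschitz (V W : normedModType R) (K : set V) (F : V -> W) :
  compact K ->
  (forall p, K p -> exists L, exists2 U, nbhs p U &
    forall u v, U u -> U v -> `|F u - F v| <= L * `|u - v|) ->
  exists2 L, 0 <= L & forall u v, K u -> K v -> `|F u - F v| <= L * `|u - v|.
Proof.
move=> cK locF.
have bnd p : K p -> \forall u \near p, `|F u| <= `|F p| + 1.
  move=> /locF[L [U nU UL]].
  have L0 : 0 < `|L| + 1 by rewrite ltr_wpDl.
  near=> u.
  have Uu : U u by near: u.
  have Up : U p := nbhs_singleton nU.
  have pu : `|p - u| <= (`|L| + 1)^-1.
    by near: u; apply: cvgr_dist_le; [exact: cvg_id|rewrite invr_gt0].
  rewrite -[F u](subrK (F p)) addrC (le_trans (ler_normD _ _))// lerD2l.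
  rewrite (le_trans (UL _ _ Uu Up))// distrC.
  rewrite (@le_trans _ _ ((`|L| + 1) * `|p - u|))//.
    by rewrite ler_wpM2r// (le_trans (ler_norm L))// lerDl.
  by rewrite -ler_pdivlMl// mulr1.
have cKK : compact (K `*` K) by exact: compact_setX.
(* Here the candidate constant [L] runs along the filter [+oo], since the estimate persists when [L]
   grows. *)
have := (compact_near_coveringP (K `*` K)).1 cKK R (+oo%R) (fun L pq =>
   `|F pq.1 - F pq.2| <= L * `|pq.1 - pq.2|) _.
have FF : Filter (+oo : set_system R) by exact: _.
move=> /(_ FF)[].
  move=> [p q] [/= Kp Kq].
  have [<-|pq] := eqVneq p q.
    have [L [U nU UL]] := locF _ Kp.
    exists (U `*` U, [set M | L <= M]) => /=.
      split => /=; first by exists (U, U).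
      by apply: nbhs_pinfty_ge; exact: num_real.
    move=> [[u v] M] /= [[Uu Uv] LM].
    by rewrite (le_trans (UL _ _ Uu Uv))// ler_wpM2r.
  pose c := `|p - q| / 2.
  have c0 : 0 < c by rewrite divr_gt0// normr_gt0 subr_eq0.
  pose M0 := (`|F p| + 1 + (`|F q| + 1)) / c.
  pose A := [set u | `|F u| <= `|F p| + 1] `&` [set u | `|p - u| <= c / 2].
  pose B := [set u | `|F u| <= `|F q| + 1] `&` [set u | `|q - u| <= c / 2].
  have nA : nbhs p A.
    apply: filterI; first exact: bnd.
    by apply: cvgr_dist_le; [exact: cvg_id|rewrite divr_gt0].
  have nB : nbhs q B.
    apply: filterI; first exact: bnd.
    by apply: cvgr_dist_le; [exact: cvg_id|rewrite divr_gt0].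
  exists (A `*` B, [set M | M0 <= M]) => /=.
    split => /=; first by exists (A, B).
    by apply: nbhs_pinfty_ge; exact: num_real.
  move=> [[u v] M] /= [[[Fu pu] [Fv qv]] LM].
  have uv : c <= `|u - v|.
    have h : `|p - q| <= `|p - u| + (`|u - v| + `|q - v|).
      rewrite -[p - q](subrKA u) (le_trans (ler_normD _ _))// lerD2l.
      by rewrite -[u - q](subrKA v) (le_trans (ler_normD _ _))// [`|q - v|]distrC.
    have : `|p - q| = c + c by rewrite /c -splitr.
    move: h pu qv => /=; lra.
  have M00 : 0 <= M0 by rewrite divr_ge0// ?ltW// !addr_ge0.
  rewrite (le_trans (ler_normB _ _))//.
  rewrite (le_trans (lerD Fu Fv))//.
  rewrite (@le_trans _ _ (M0 * c))//; first by rewrite /M0 divfK// gt_eqF.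
  by apply: ler_pM => //; exact: ltW.
(* [HM] covers the constants strictly beyond [M], hence [M + 1]; the maximum with 0 provides the
   sign. *)
move=> M [_ HM]; exists (Num.max 0 (M + 1)); first by rewrite le_max lexx.
move=> u v Ku Kv.
have := HM (M + 1); rewrite ltrDl ltr01 => /(_ isT)/(_ (u, v) (conj Ku Kv))/=.
by move=> /le_trans; apply; rewrite ler_wpM2r// le_max lexx orbT.
Unshelve. all: by end_near. Qed.

End lipschitz_extension.

(** * Smoothing *)

Section balls.
Context {R : realType}.

Lemma enorm_lipschitz n (u v : 'rV[R]_n) : `|enorm u - enorm v| <= n%:R * `|u - v|.
Proof.
have half (a b : 'rV[R]_n) : enorm a - enorm b <= n%:R * `|a - b|.
  rewrite lerBlDr (le_trans _ (lerD (enorm_le_norm _) (lexx _)))//.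
  by rewrite (le_trans _ (enormD _ _))// subrK.
by rewrite ler_norml lerNl opprB half andbT distrC half.
Qed.

Lemma compact_closed_eball n (x : 'rV[R]_n) (r : R) : compact (closed_eball x r).
Proof.
apply: bounded_closed_compact.
  exists (r + `|x|); split; first exact: num_real.
  move=> M rM u ur; apply: le_trans (ltW rM); rewrite -[u](subrK x).
  by rewrite (le_trans (ler_normD _ _))// lerD2r (le_trans (norm_le_enorm _)).
rewrite (_ : closed_eball x r = (fun u => enorm (u - x)) @^-1` [set s | s <= r])//.
apply: preimage_closed; last exact: closed_le.
move=> u _; apply: (@lipschitz_continuous R _ _ _ n%:R) => v w.
rewrite (le_trans (enorm_lipschitz _ _))// opprB addrA subrK.
by [].
Qed.

(** Compactness gives a margin [eta] valid around every point of the ball. A point of the larger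
    ball is contracted towards [x] by the factor [delta / (delta + eta)]: it lands in the smaller
    ball and moves by at most [eta]. *)
Lemma closed_eball_enlarge n (N : set 'rV[R]_n) (x : 'rV[R]_n) (delta : R) :
  open N -> 0 < delta -> closed_eball x delta `<=` N ->
  exists2 eta, 0 < eta & closed_eball x (delta + eta) `<=` N.
Proof.
move=> oN d0 xN.
have FF : Filter (0^'+ : set_system R) by exact: _.
have := (compact_near_coveringP _).1 (@compact_closed_eball n x delta) R (0^'+)
  (fun eta p => forall s, `|s - p| <= eta -> N s) FF.
case=> [p Kp|r /= r0 Hr].
  have /nbhs_ballP[r /= r0 rN] := open_nbhs_nbhs (conj oN (xN _ Kp)).
  have r2 : 0 < r / 2 by rewrite divr_gt0.
  exists (ball p (r / 2), [set eta | eta < r / 2]).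
    by split => /=; [exact: nbhsx_ballx|exact: nbhs_right_lt].
  move=> [p' eta] /= [pp' er] s sp'; apply: rN.
  move: pp'; rewrite -!ball_normE/= => pp'.
  rewrite -[p - s](subrKA p') (le_lt_trans (ler_normD _ _))//.
  by rewrite [ltRHS]splitr ltrD// distrC (le_lt_trans sp').
have r2 : 0 < r / 2 by rewrite divr_gt0.
exists (r / 2) => // s sx.
have H p : closed_eball x delta p -> `|s - p| <= r / 2 -> N s.
  move=> Kp; apply: (Hr (r / 2)) => //=.
  by rewrite sub0r normrN gtr0_norm// ltr_pdivrMr// ltr_pMr// ltr1n.
have dr0 : 0 < delta + r / 2 by rewrite addr_gt0.
pose l := delta / (delta + r / 2).
have l0 : 0 <= l by rewrite divr_ge0// ltW.
have l1 : 1 - l = (r / 2) / (delta + r / 2).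
  have dr0' : delta + r / 2 != 0 by rewrite gt_eqF.
  by rewrite /l -[X in X - _](divff dr0') -mulrBl addrAC subrr add0r.
apply: (H (x + l *: (s - x))).
  rewrite /closed_eball/= addrAC subrr add0r enormZ ger0_norm//.
  by rewrite /l mulrAC ler_pdivrMr// ler_wpM2l// ltW.
apply: (le_trans (norm_le_enorm _)).
have -> : s - (x + l *: (s - x)) = (1 - l) *: (s - x).
  by rewrite scalerBl scale1r opprD addrA.
rewrite enormZ l1 ger0_norm; last by rewrite divr_ge0// ltW.
by rewrite mulrAC ler_pdivrMr// ler_wpM2l// ltW.
Qed.

End balls.

Section smoothing_jacobian.
Context {R : realType} {n m : nat}.
Local Notation P := (@uniform_ball R n).
Local Notation B := (@tuple_ball R n).
Local Notation W := (@rV_of_tuple R n).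
Variables (N : set 'rV[R]_n) (y : 'rV[R]_n -> 'rV[R]_m).
Hypotheses (oN : open N) (ylip : locally_lipschitz N y).

Lemma locally_lipschitz_norm p : N p -> exists L, exists2 U, nbhs p U &
    forall u v, U u -> U v -> `|y u - y v| <= L * `|u - v|.
Proof.
move=> Np; have [K [U nU UK]] := ylip Np.
exists (`|K| * n%:R), (N `&` U) => [|u v Nu Nv].
  by apply: filterI => //; exact: open_nbhs_nbhs.
rewrite (le_trans (norm_le_enorm _))// (le_trans (UK _ _ Nu Nv))//.
rewrite (@le_trans _ _ (`|K| * enorm (u - v)))//.
  by rewrite ler_wpM2r ?enorm_ge0// ler_norm.
by rewrite -mulrA ler_wpM2l// enorm_le_norm.
Qed.

(* [z] is the rescaled McShane extension of [y] from a ball slightly larger than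
   [closed_eball x delta]: it is globally Lipschitz. *)
Lemma local_extension (x : 'rV[R]_n) (delta : R) : 0 < delta ->
  closed_eball x delta `<=` N ->
  exists (L eta : R) (z : 'rV[R]_n -> 'rV[R]_m),
  [/\ 0 < eta, closed_eball x (delta + eta) `<=` N,
    forall u w, `|z u - z w| <= L * `|u - w| &
    forall u, closed_eball x (delta + eta) (x + delta *: u) ->
      z u = y (x + delta *: u)].
Proof.
move=> d0 xN; have [eta eta0 etaN] := closed_eball_enlarge oN d0 xN.
have [L L0 yL] := compact_lipschitz (@compact_closed_eball R n x (delta + eta))
  (fun p Kp => locally_lipschitz_norm (etaN p Kp)).
have Kx : closed_eball x (delta + eta) !=set0.
  by exists x; rewrite /closed_eball/= subrr enorm0 addr_ge0// ltW.
have /choice[G GP] i : exists G : 'rV[R]_n -> R,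
    (forall u, closed_eball x (delta + eta) u -> G u = y u 0 i) /\
    forall u v, `|G u - G v| <= L * `|u - v|.
  apply: mcshane_extension => // u v Ku Kv; rewrite (le_trans _ (yL u v Ku Kv))//.
  by have := coord_le_norm (y u - y v) i; rewrite !mxE.
exists (L * delta), eta, (fun u => \row_i G i (x + delta *: u)); split => //.
  move=> u w; apply/row_norm_leP => [|i]; first by rewrite !mulr_ge0// ltW.
  rewrite !mxE (le_trans ((GP i).2 _ _))//.
  rewrite opprD addrACA subrr add0r -scalerBr normrZ gtr0_norm//.
  by rewrite mulrA.
by move=> u Ku; apply/rowP => i; rewrite mxE (GP i).1.
Qed.

Lemma has_jac_rescale (F : 'rV[R]_n -> 'rV[R]_m) (x v : 'rV[R]_n) (delta : R) J :
  0 < delta -> has_jac (fun u => F (x + delta *: u)) v J ->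
  has_jac F (x + delta *: v) (delta^-1 *: J).
Proof.
move=> d0 FJ e e0.
have ed : 0 < e * delta by rewrite mulr_gt0.
have [r r0 Hr] := FJ _ ed; exists (delta * r); first by rewrite mulr_gt0.
move=> h hr.
have hr' : `|delta^-1 *: h| < r.
  by rewrite normrZ gtr0_norm ?invr_gt0// ltr_pdivrMl.
have := Hr _ hr'; rewrite scalerDr scalerA divff ?gt_eqF// scale1r addrA.
rewrite linearZ/= -scalemxAl -scalemxAr normrZ gtr0_norm ?invr_gt0//.
by rewrite mulrA mulfK// gt_eqF.
Qed.

Lemma has_jac_near (F G : 'rV[R]_n -> 'rV[R]_m) (v : 'rV[R]_n) J r :
  0 < r -> (forall h, `|h| < r -> F (v + h) = G (v + h)) ->
  has_jac F v J -> has_jac G v J.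
Proof.
move=> r0 FG FJ e /FJ[s s0 Hs].
exists (Num.min r s); first by rewrite lt_min r0.
move=> h; rewrite lt_min => /andP[hr hs]; rewrite -(FG h hr).
have := FG 0; rewrite normr0 addr0 => /(_ r0) <-.
exact: Hs.
Qed.

(** Near [x], the smoothing at [u] is the mean over the unit ball of the extension [z] translated by
    [(u - x) / delta]; [mean_jacobian] differentiates it at translation 0. *)
Lemma smoothing_jacobian (x : 'rV[R]_n) (delta : R) : 0 < delta ->
  closed_eball x delta `<=` N ->
  exists (J : n.-tuple R -> 'M[R]_(m, n)) (L : R),
  [/\ forall i j, measurable_fun setT (fun t => J t i j),
      forall t i j, `|J t i j| <= L,
      {ae P, forall t, B t -> has_jac y (x + delta *: W t) (J t)} &
      has_jac (smoothing y delta) x (\matrix_(i, j) \int[P]_(t in B) J t i j)].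
Proof.
move=> d0 xN; have [L [eta [z [eta0 etaN zL zy]]]] := local_extension d0 xN.
have [J [mJ JL aeJ Jmean]] := mean_jacobian zL.
(* [z] lives on the scale of the unit ball, so its Jacobians are divided by [delta]. *)
exists (fun t => delta^-1 *: J t), (delta^-1 * `|L|).
have n1 : 0 < n%:R + 1 :> R by rewrite ltr_wpDl.
have near_ball (h : 'rV[R]_n) : `|h| < eta / (n%:R + 1) -> enorm h <= eta.
  move=> he; apply: (le_trans (enorm_le_norm _)).
  apply: (@le_trans _ _ ((n%:R + 1) * `|h|)); first by rewrite ler_wpM2r// lerDl.
  by rewrite mulrC -ler_pdivlMr// ltW.
have inK t (h : 'rV[R]_n) : B t -> `|h| < eta / (n%:R + 1) ->
    closed_eball x (delta + eta) (x + (delta *: W t + h)).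
  move=> Bt he; rewrite /closed_eball/= addrAC subrr add0r.
  rewrite (le_trans (enormD _ _))// lerD ?near_ball//.
  by rewrite enormZ gtr0_norm// ger_pMr.
have r0 : 0 < eta / (n%:R + 1) by rewrite divr_gt0.
have dK (h : 'rV[R]_n) : delta *: (delta^-1 *: h) = h.
  by rewrite scalerA divff ?scale1r// gt_eqF.
split.
- move=> i j; under eq_fun do rewrite mxE.
  exact: measurable_funM.
- by move=> t i j; rewrite mxE normrM gtr0_norm ?invr_gt0// ler_wpM2l// invr_ge0 ltW.
- apply: filterS aeJ => t Jt Bt.
  have zE u : z u = (fun s => z (delta^-1 *: (s - x))) (x + delta *: u).
    by rewrite addrAC subrr add0r scalerA mulVf ?scale1r// gt_eqF.
  have Jt' : has_jac (fun u => (fun s => z (delta^-1 *: (s - x))) (x + delta *: u)) (W t) (J t).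
    by rewrite (_ : (fun u => _) = z)//; apply/funext => u; rewrite -zE.
  apply: (has_jac_near r0 _
    (has_jac_rescale (F := fun s => z (delta^-1 *: (s - x))) d0 Jt')) => h hr.
  have := inK t h Bt hr; rewrite addrA => K.
  have xK (u : 'rV[R]_n) : x + (u - x) = u by rewrite addrC subrK.
  by rewrite zy dK xK.
have Jz : has_jac (fun u => (fun s => \row_i \int[P]_(t in B) z (W t + delta^-1 *: (s - x)) 0 i)
    (x + delta *: u)) 0 (\matrix_(i, j) \int[P]_(t in B) J t i j).
  rewrite (_ : (fun u => _) = (fun h => \row_i \int[P]_(t in B) z (W t + h) 0 i))//.
  apply/funext => u; apply/rowP => i; rewrite !mxE; apply: eq_Rintegral => t _.
  by rewrite addrAC subrr add0r scalerA mulVf ?scale1r// gt_eqF.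
have := has_jac_rescale
  (F := fun s => \row_i \int[P]_(t in B) z (W t + delta^-1 *: (s - x)) 0 i) d0 Jz.
rewrite scaler0 addr0.
have -> : delta^-1 *: (\matrix_(i, j) \int[P]_(t in B) J t i j) =
    \matrix_(i, j) \int[P]_(t in B) (delta^-1 *: J t) i j.
  apply/matrixP => i j; rewrite !mxE; under [in RHS]eq_Rintegral do rewrite mxE.
  rewrite RintegralZl//; first exact: measurable_tuple_ball.
  apply: (@bounded_integrable _ _ _ _ _ (@measurable_tuple_ball R n) _ `|L|) => //.
  exact: measurable_funTS.
apply: has_jac_near r0 _ => h hr; apply/rowP => i; rewrite !mxE.
rewrite unlock /Rintegral; congr fine.
(* The expectation ranges over all tuples, and outside the ball nothing is known of [y], not even
   measurability; the null complement is discarded first. *)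
rewrite [RHS](integral_full_set _ (@measurable_tuple_ball R n) (@uniform_ball_setC R n)).
apply: eq_integral => t /set_mem Bt; congr EFin.
have K := inK t h Bt hr.
have E : x + delta *: (W t + delta^-1 *: (x + h - x)) = x + (delta *: W t + h).
  by rewrite scalerDr dK [x + h - x]addrAC subrr add0r.
rewrite zy E//; congr (y _ _ _).
by rewrite addrA [x + h + _]addrAC.
Qed.

End smoothing_jacobian.

(** * Clarke Jacobians *)

Section clarke_facts.
Context {R : realType} {n m : nat}.
Variables (N : set 'rV[R]_n) (y : 'rV[R]_n -> 'rV[R]_m).
Hypotheses (oN : open N) (ylip : locally_lipschitz N y).

Lemma convex_conv_hull p q (A : set 'M[R]_(p, q)) :
  @convex_set R 'M[R]_(p, q) (conv_hull A).
Proof.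
apply/convex_setP => v w l Av Aw l0 l1 C [cC AC].
by apply: ((convex_setP C).1 cC _ _ _ _ _ l0 l1);
  [exact: (Av C (conj cC AC))|exact: (Aw C (conj cC AC))].
Qed.

Lemma sub_conv_hull p q (A : set 'M[R]_(p, q)) : A `<=` conv_hull A.
Proof. exact: sub_smallest. Qed.

Lemma clarke_jacobian_diff s : N s -> differentiable y s ->
  clarke_jacobian N y s (Jac y s).
Proof.
move=> Ns ys; apply: sub_conv_hull; exists (fun=> s).
by split => //; apply: cvg_cst.
Qed.

Lemma has_jac_coord_le (s : 'rV[R]_n) (J : 'M[R]_(m, n)) (L r : R) i j :
  0 < r -> (forall h, `|h| < r -> `|y (s + h) - y s| <= L * `|h|) ->
  has_jac y s J -> `|J i j| <= L.
Proof.
move=> r0 yL yJ; apply/ler_addgt0Pr => e e0.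
have [q q0 Hq] := yJ e e0.
pose t := Num.min r q / 2.
have m0 : 0 < Num.min r q by rewrite lt_min r0.
have t0 : 0 < t by rewrite divr_gt0.
have /andP[tr tq] : (t < r) && (t < q).
  by rewrite -lt_min /t ltr_pdivrMr// ltr_pMr// ltr1n.
pose h : 'rV[R]_n := t *: delta_mx 0 j.
have ht : `|h| <= t by rewrite normrZ gtr0_norm// ger_pMr// norm_delta.
have H1 := yL h (le_lt_trans ht tr); have H2 := Hq h (le_lt_trans ht tq).
have hJ : (h *m J^T) 0 i = t * J i j.
  by rewrite -scalemxAl mxE -rowE !mxE.
have H3 : t * `|J i j| <= (L + e) * `|h|.
  rewrite -[X in X * `|_|](gtr0_norm t0) -normrM -hJ (le_trans (coord_le_norm _ _))//.
  have -> : h *m J^T = (y (s + h) - y s) - (y (s + h) - y s - h *m J^T).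
    by rewrite opprB addrC subrK.
  by rewrite (le_trans (ler_normB _ _))// mulrDl lerD.
have Le : 0 <= L + e.
  have : 0 <= (L + e) * `|h| by apply: le_trans H3; rewrite mulr_ge0// ltW.
  have [h0|hn0] := eqVneq `|h| 0; last first.
    by rewrite pmulr_lge0// lt_neqAle eq_sym hn0 normr_ge0.
  move: h0 => /eqP; rewrite normr_eq0 => /eqP h0.
  have : h 0 j = 0 by rewrite h0 mxE.
  rewrite !mxE !eqxx mulr1 => t00; by move: t0; rewrite t00 ltxx.
rewrite -(ler_pM2l t0) (le_trans H3)// mulrC ler_wpM2r//.
Qed.

(** Bolzano-Weierstrass for vectorized matrices. The map [phi] may fail to be increasing, but
    [k <= phi k] is enough to transport limits at infinity. *)
Lemma bounded_matrix_subseq (J : nat -> 'M[R]_(m, n)) (L : R) :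
  (forall k i j, `|J k i j| <= L) ->
  exists (V : 'M[R]_(m, n)) (phi : nat -> nat),
    (forall k, (k <= phi k)%N) /\ (fun k => J (phi k)) @ \oo --> V.
Proof.
move=> JL.
have L0 k : `|mxvec (J k)| <= `|L|.
  apply/row_norm_leP => // i; case/mxvec_indexP: i => a b.
  by rewrite mxvecE (le_trans (JL _ _ _))// ler_norm.
have cK : compact [set v : 'rV[R]_(m * n) | `|v| <= `|L|].
  apply: bounded_closed_compact.
    by exists `|L|; split; [exact: num_real|move=> M LM v /= /le_trans; apply; exact: ltW].
  rewrite (_ : [set v | _] = (fun v : 'rV[R]_(m * n) => `|v|) @^-1` [set s | s <= `|L|])//.
  apply: preimage_closed; last exact: closed_le.
  by move=> v _; exact: norm_continuous.
have FL : ((fun k => mxvec (J k)) @ \oo) [set v : 'rV[R]_(m * n) | `|v| <= `|L|].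
  by exists 0%N => // k _; exact: L0.
have [v [_ clv]] := cK _ _ FL.
have /choice[phi phiP] k : exists l, (k <= l)%N /\ `|v - mxvec (J l)| < k.+1%:R^-1.
  have [||w [[l /= kl <-] vw]] := clv [set mxvec (J l) | l in [set l | (k <= l)%N]]
      (ball v k.+1%:R^-1).
  - by exists k => // l /= kl; exists l.
  - by apply: nbhsx_ballx; rewrite invr_gt0.
  by exists l; split => //; move: vw; rewrite -ball_normE.
exists (vec_mx v), phi; split; first by move=> k; have [] := phiP k.
apply/cvgrPdist_le => e e0.
have [K _ HK] := near_infty_natSinv_lt (PosNum e0).
exists K => // k /HK /= ke.
rewrite /Num.norm/= mx_normrE; apply/bigmax_leP; split => [|[i j] _ /=]; first exact: ltW.
have -> : (vec_mx v - J (phi k)) i j = (v - mxvec (J (phi k))) 0 (mxvec_index i j).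
  by rewrite -[LHS]mxvecE linearB/= vec_mxK.
by rewrite (le_trans (coord_le_norm _ _))// (le_trans (ltW (phiP k).2))// ltW.
Qed.

(** Guards against the infimum [+oo] of an empty set. Balls shrinking to [x] contain points of
    differentiability, by the almost-everywhere clause of [smoothing_jacobian]; the Jacobians there
    are bounded, so a subsequence converges. *)
Lemma clarke_jacobian_neq0 x : N x -> clarke_jacobian N y x !=set0.
Proof.
move=> Nx; have [L [U nU UL]] := locally_lipschitz_norm oN ylip Nx.
have /nbhs_ballP[r /= r0 rUN] : nbhs x (U `&` N).
  by apply: filterI => //; exact: open_nbhs_nbhs.
have H k : exists s, [/\ N s, differentiable y s, `|s - x| <= k.+1%:R^-1
    & forall i j, `|Jac y s i j| <= L].
  (* At most [r / 2], so that increments below [r / 2] from a point of the small ball remain where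
     the local Lipschitz bound holds. *)
  pose d := Num.min (r / 2) k.+1%:R^-1.
  have r2 : 0 < r / 2 by rewrite divr_gt0.
  have d0 : 0 < d by rewrite lt_min r2 invr_gt0 ltr0n.
  have dr : d <= r / 2 by rewrite ge_min lexx.
  have rr : r / 2 < r by rewrite ltr_pdivrMr// ltr_pMr// ltr1n.
  have inball s : `|s - x| < r -> U s /\ N s.
    by move=> sr; apply: rUN; rewrite -ball_normE/= distrC.
  have xN : closed_eball x d `<=` N.
    move=> s sd; apply: (inball _ _).2.
    by rewrite (le_lt_trans (norm_le_enorm _))// (le_lt_trans sd)// (le_lt_trans dr).
  have [J [M [_ _ aeJ _]]] := smoothing_jacobian oN ylip d0 xN.
  have [t [Bt yt]] : exists t, @tuple_ball R n t /\
      has_jac y (x + d *: rV_of_tuple t) (J t).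
    apply: contrapT => no.
    have [A [mA A0 sA]] := aeJ.
    have BA : @tuple_ball R n `<=` A.
      by move=> t Bt; apply: sA => /= h; apply: no; exists t; split => //; exact: h.
    have : (@uniform_ball R n setT <= 0)%E.
      rewrite -(setUv (@tuple_ball R n)) (le_trans (measureU2 _ _ _))//.
      - exact: measurable_tuple_ball.
      - by apply: measurableC; exact: measurable_tuple_ball.
      rewrite [X in (_ + X)%E](uniform_ball_setC n) adde0 -A0 le_measure// inE//.
      exact: measurable_tuple_ball.
    by rewrite probability_setT lee_fin ler10.
  set s := x + d *: rV_of_tuple t.
  have sd : `|s - x| <= d.
    rewrite /s addrAC subrr add0r normrZ gtr0_norm// ger_pMr//.
    exact: le_trans (norm_le_enorm _) Bt.
  have [ds sE] := has_jacP yt.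
  have [Us Ns] := inball s (le_lt_trans sd (le_lt_trans dr rr)).
  exists s; split => //; first by rewrite (le_trans sd)// ge_min lexx orbT.
  move=> i j; rewrite sE; apply: has_jac_coord_le (r2) _ yt => h hr.
  rewrite (le_trans (UL _ _ _ Us))//; last by rewrite addrAC subrr add0r.
  apply: (inball _ _).1; rewrite addrAC (le_lt_trans (ler_normD _ _))//.
  by rewrite [ltRHS]splitr ler_ltD// (le_trans sd).
have [s sP] := choice H.
have [V [phi [phik JV]]] := @bounded_matrix_subseq (fun k => Jac y (s k)) L
  (fun k => let: And4 _ _ _ h := sP k in h).
exists V; apply: sub_conv_hull; exists (s \o phi); split => //=.
  by move=> k; have [? ? _ _] := sP (phi k).
apply/cvgrPdist_le => e e0.
have [K _ HK] := near_infty_natSinv_lt (PosNum e0).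
exists K => // k /= Kk; have /HK /= ke : (K <= phi k)%N by exact: leq_trans Kk (phik k).
by have [_ _ h _] := sP (phi k); rewrite distrC (le_trans h)// ltW.
Qed.

End clarke_facts.

Lemma differentiable_id (R : realType) (V : normedModType R) (v : V) :
  differentiable id v.
Proof. exact: ex_diff. Qed.

Section partial_diff.
Context {R : realType} {U V1 V2 W : normedModType R}.

Lemma diff_comp_pair (phi : V1 * V2 -> W) (f : U -> V1) (g : U -> V2) (u : U) :
  differentiable phi (f u, g u) -> differentiable f u -> differentiable g u ->
  differentiable (fun s => phi (f s, g s)) u /\
  forall h, 'd (fun s => phi (f s, g s)) u h =
    'd phi (f u, g u) ('d f u h, 'd g u h).
Proof.
move=> dphi df dg.
have dfg : differentiable (fun s => (f s, g s)) u by exact: differentiable_pair.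
split=> [|h].
  exact: (@differentiable_comp _ _ _ _ (fun s => (f s, g s)) phi).
rewrite -[fun s => phi (f s, g s)]/(phi \o (fun s => (f s, g s))).
by rewrite diff_comp//= diff_pair.
Qed.

End partial_diff.

Section chain_rule.
Context {R : realType} {n m : nat}.
Variables (N : set 'rV[R]_n) (y : 'rV[R]_n -> 'rV[R]_m).
Variable phi : 'rV[R]_n * 'rV[R]_m -> R.
Hypotheses (oN : open N) (ylip : locally_lipschitz N y) (phiC1 : C1 phi).

(** [grad1] and [grad2] only collect directional derivatives; joint differentiability of [phi] lets
    the increment be split into its two components. *)
Lemma diff_phi (a h : 'rV[R]_n) (b k : 'rV[R]_m) :
  'd phi (a, b) (h, k) = dotv (grad1 phi (a, b)) h + dotv (grad2 phi (a, b)) k.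
Proof.
have [dphi _ _] := phiC1.
have -> : (h, k) = (h, 0) + (0, k) :> 'rV[R]_n * 'rV[R]_m.
  by apply/pair_equal_spec; rewrite /= addr0 add0r.
rewrite linearD/=; congr (_ + _).
  have [d1 d1E] := @diff_comp_pair _ _ _ _ _ phi id (cst b) a (dphi _)
    (@differentiable_id R _ a) (differentiable_cst b a).
  have <- : 'd (fun s => phi (id s, cst b s)) a h = 'd phi (a, b) (h, 0).
    by rewrite d1E diff_cst diff_val.
  rewrite linear_dotv; congr (dotv _ _); apply/rowP => j; rewrite !mxE.
  by rewrite deriveE.
have [d1 d1E] := @diff_comp_pair _ _ _ _ _ phi (cst a) id b (dphi _)
  (differentiable_cst a b) (@differentiable_id R _ b).
have <- : 'd (fun s => phi (cst a s, id s)) b k = 'd phi (a, b) (0, k).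
  by rewrite d1E diff_cst diff_val.
rewrite linear_dotv; congr (dotv _ _); apply/rowP => j; rewrite !mxE.
by rewrite deriveE.
Qed.

Lemma grad_phi_tilde u : differentiable y u ->
  differentiable (phi_tilde y phi) u /\
  grad (phi_tilde y phi) u = d_x y phi u + d_y y phi u *m Jac y u.
Proof.
move=> dy; have [dphi _ _] := phiC1.
have [d1 d1E] := @diff_comp_pair _ _ _ _ _ phi id y u (dphi _)
  (@differentiable_id R _ u) dy.
split => //; apply/rowP => j; rewrite [LHS]mxE deriveE//.
rewrite [LHS]d1E diff_val diff_phi [RHS]mxE; congr (_ + _).
  by have := dotv_delta (grad1 phi (u, y u)) 1 j; rewrite scale1r mul1r.
rewrite [RHS]mxE; apply: eq_bigr => i _; congr (_ * _).
by rewrite /Jac [RHS]mxE /jacobian [RHS]mxE.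
Qed.

End chain_rule.

(** * Chain rule and gaps *)

Lemma cvg_mulmx (R : realType) (m n : nat) (A : nat -> 'rV[R]_m)
    (B : nat -> 'M[R]_(m, n)) (a : 'rV[R]_m) (b : 'M[R]_(m, n)) :
  A @ \oo --> a -> B @ \oo --> b -> (fun k => A k *m B k) @ \oo --> a *m b.
Proof.
move=> Aa Bb; apply/cvgrPdist_le => e e0.
pose c := m%:R * (`|a| + 1) + m%:R * `|b| + 1.
have c0 : 0 < c by rewrite ltr_wpDl// !addr_ge0// !mulr_ge0// addr_ge0.
have ec0 : 0 < e / c by rewrite divr_gt0.
near=> k.
have Ak1 : `|a - A k| <= 1 by near: k; apply: cvgr_dist_le.
have Ak : `|a - A k| <= e / c by near: k; apply: cvgr_dist_le.
have Bk : `|b - B k| <= e / c by near: k; apply: cvgr_dist_le.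
have Ak2 : `|A k| <= `|a| + 1.
  rewrite -[A k](subrK a) addrC (le_trans (ler_normD _ _))// lerD2l.
  by rewrite distrC.
have -> : a *m b - A k *m B k = (a - A k) *m b + A k *m (b - B k).
  by rewrite mulmxBl mulmxBr addrA subrK.
have -> : e = c * (e / c) by rewrite mulrC divfK// gt_eqF.
apply: (le_trans (ler_normD _ _)).
apply: (@le_trans _ _ (m%:R * `|b| * (e / c) + m%:R * (`|a| + 1) * (e / c))); last first.
  rewrite -mulrDl ler_wpM2r ?ltW// /c; lra.
apply: lerD; first by rewrite (le_trans (mulmx_norm _ _))// ler_wpM2l// mulr_ge0.
rewrite (le_trans (mulmx_norm _ _))// mulrAC ler_pM ?mulr_ge0//.
by rewrite ler_wpM2l.
Unshelve. all: by end_near. Qed.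

Lemma lipschitz_near_continuous (R : realType) (V W : normedModType R)
    (F : V -> W) (x : V) (U : set V) (L : R) : nbhs x U ->
  (forall u v, U u -> U v -> `|F u - F v| <= L * `|u - v|) ->
  {for x, continuous F}.
Proof.
move=> nU UL; apply/cvgrPdist_le => e e0.
have L0 : 0 < `|L| + 1 by rewrite ltr_wpDl.
near=> u.
have Uu : U u by near: u.
have Ux : U x := nbhs_singleton nU.
have xu : `|x - u| <= e / (`|L| + 1).
  by near: u; apply: cvgr_dist_le; [exact: cvg_id|rewrite divr_gt0].
apply: (le_trans (UL _ _ Ux Uu)).
apply: (@le_trans _ _ ((`|L| + 1) * `|x - u|)).
  by rewrite ler_wpM2r// (le_trans (ler_norm L))// lerDl.
by rewrite mulrC -ler_pdivlMr.
Unshelve. all: by end_near. Qed.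

Section clarke_chain_rule.
Context {R : realType} {n m : nat}.
Variables (N : set 'rV[R]_n) (y : 'rV[R]_n -> 'rV[R]_m).
Variable phi : 'rV[R]_n * 'rV[R]_m -> R.
Hypotheses (oN : open N) (ylip : locally_lipschitz N y) (phiC1 : C1 phi).

Lemma continuous_response x : N x -> {for x, continuous y}.
Proof.
move=> Nx; have [L [U nU UL]] := locally_lipschitz_norm oN ylip Nx.
exact: lipschitz_near_continuous nU UL.
Qed.

(** Where [y] is differentiable, so is [phi_tilde], hence a sequence generating an element of the
    Clarke Jacobian also generates its image; continuity of the partial gradients gives the
    limit. *)
Lemma clarke_subdiff_chain x V : N x -> clarke_jacobian N y x V ->
  clarke_subdiff N (phi_tilde y phi) x (d_x y phi x + d_y y phi x *m V).
Proof.
move=> Nx VJ.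
(* [conv_hull] is an intersection of convex supersets, so it suffices that this set is convex and
   contains the limits. *)
apply: (VJ [set V | clarke_subdiff N (phi_tilde y phi) x
  (d_x y phi x + d_y y phi x *m V)]); split.
  apply/convex_setP => V1 V2 l H1 H2 l0 l1 /=.
  have -> : d_x y phi x + d_y y phi x *m (l *: V1 + (1 - l) *: V2) =
     l *: (d_x y phi x + d_y y phi x *m V1) +
     (1 - l) *: (d_x y phi x + d_y y phi x *m V2).
    rewrite mulmxDr -!scalemxAr !scalerDr addrACA -scalerDl.
    by rewrite [l + _]addrC subrK scale1r.
  exact: ((convex_setP _).1 (@convex_conv_hull _ _ _ _) _ _ _ H1 H2 l0 l1).
move=> {VJ}V [u [uP ux uV]]; apply: sub_conv_hull; exists u; split => //.
  by move=> k; have [Nu du] := uP k; split => //; exact: (grad_phi_tilde phiC1 du).1.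
have gradE : (fun k => grad (phi_tilde y phi) (u k)) =
    (fun k => d_x y phi (u k) + d_y y phi (u k) *m Jac y (u k)).
  by apply/funext => k; exact: (grad_phi_tilde phiC1 (uP k).2).2.
rewrite gradE; have [_ c1 c2] := phiC1.
have yux : (fun k => y (u k)) @ \oo --> y x.
  exact: (cvg_comp _ _ ux (continuous_response Nx)).
have pux : (fun k => (u k, y (u k))) @ \oo --> (x, y x).
  exact: (cvg_pair ux yux).
have h1 : (fun k => d_x y phi (u k)) @ \oo --> d_x y phi x.
  exact: (cvg_comp _ _ pux (c1 (x, y x))).
have h2 : (fun k => d_y y phi (u k)) @ \oo --> d_y y phi x.
  exact: (cvg_comp _ _ pux (c2 (x, y x))).
exact: (cvgD h1 (cvg_mulmx h2 uV)).
Qed.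

End clarke_chain_rule.

Section gaps.
Context {R : realType} {n m : nat}.
Variable X : set 'rV[R]_n.
Hypotheses (X0 : X !=set0) (cX : compact X).

Lemma diam_has_sup : has_sup [set enorm (p.1 - p.2) | p in X `*` X].
Proof.
have [M [_ HM]] := compact_bounded cX.
have XM u : X u -> `|u| <= `|M| + 1.
  by apply: HM; rewrite (le_lt_trans (ler_norm M))// ltrDl.
split.
  by have [x Xx] := X0; exists (enorm (x - x)), (x, x).
exists (n%:R * (`|M| + 1 + (`|M| + 1))) => _ [[u v] /= [Xu Xv] <-].
rewrite (le_trans (enorm_le_norm _))// ler_wpM2l// (le_trans (ler_normB _ _))//.
by rewrite lerD// XM.
Qed.

Lemma enorm_le_diam u v : X u -> X v -> enorm (u - v) <= diam X.
Proof.
by move=> Xu Xv; apply: ub_le_sup; [case: diam_has_sup|exists (u, v)].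
Qed.

Lemma diam_ge0 : 0 <= diam X.
Proof.
by have [x Xx] := X0; rewrite (le_trans (enorm_ge0 (x - x)))// enorm_le_diam.
Qed.

Lemma fw_gap_ge x g z : X x -> X z -> dotv (z - x) (- g) <= fw_gap X x g.
Proof.
move=> Xx Xz; apply: ub_le_sup; last by exists z.
exists (diam X * enorm (- g)) => _ [w Xw <-].
rewrite (le_trans (cauchy_schwarz _ _))// ler_wpM2r ?enorm_ge0//.
exact: enorm_le_diam.
Qed.

(** The two linear functionals differ by the pairing of [z - x] with [d *m (M - V)], which
    Cauchy-Schwarz bounds uniformly over [z] in [X]. *)
Lemma fw_gap_perturb x (g : 'rV[R]_n) (d : 'rV[R]_m) (V M : 'M[R]_(m, n)) : X x ->
  fw_gap X x (g + d *m V) <=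
    fw_gap X x (g + d *m M) + diam X * enorm d * opnorm (M - V).
Proof.
move=> Xx; apply: ge_sup; first by have [z Xz] := X0; exists (dotv (z - x) (- (g + d *m V))), z.
move=> _ [z Xz <-].
have -> : - (g + d *m V) = - (g + d *m M) + d *m (M - V).
  by rewrite mulmxBr !opprD addrA subrK.
rewrite dotvDr lerD ?fw_gap_ge// dotvC dotv_mulmx (le_trans (cauchy_schwarz _ _))//.
rewrite [leRHS]mulrAC mulrC ler_wpM2r ?enorm_ge0//.
rewrite (le_trans (opnorm_bound _ _))// mulrC ler_wpM2r ?opnorm_ge0//.
exact: enorm_le_diam.
Qed.

End gaps.

(** * The structural bias *)

Section main_inequality.
Context {R : realType} {n m : nat}.
Variables (X N : set 'rV[R]_n) (y : 'rV[R]_n -> 'rV[R]_m).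
Variable phi : 'rV[R]_n * 'rV[R]_m -> R.
Hypotheses (X0 : X !=set0) (cX : compact X).
Hypotheses (oN : open N) (ylip : locally_lipschitz N y) (phiC1 : C1 phi).
Variables (x : 'rV[R]_n) (delta : R).
Hypotheses (Xx : X x) (delta_gt0 : 0 < delta) (xN : closed_eball x delta `<=` N).

Let Nx : N x.
Proof. by apply: xN; rewrite /closed_eball/= subrr enorm0 ltW. Qed.

(** The supremum of an empty set is [-oo], so an element of the Clarke Jacobian at [x] itself has to
    be exhibited. *)
Lemma set_variation_ge0 : (0 <= set_variation N y x delta)%E.
Proof.
have [V VJ] := clarke_jacobian_neq0 oN ylip Nx.
apply: (@le_trans _ _ (mxdist V (clarke_jacobian N y x))); first exact: mxdist_ge0.
apply: (@le_trans _ _ (ereal_sup [set mxdist V (clarke_jacobian N y x)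
    | V in clarke_jacobian N y x])).
  by apply: ereal_sup_ubound; exists V.
by apply: ereal_sup_ubound; exists x => //; rewrite /closed_eball/= subrr enorm0 ltW.
Qed.

Lemma smoothing_jacobian_approx (w : R) : (set_variation N y x delta <= w%:E)%E ->
  forall e, 0 < e -> exists2 V, clarke_jacobian N y x V &
    opnorm (Jac (smoothing y delta) x - V) < w + e.
Proof.
move=> Sw e e0.
have [J [L [mJ JL aeJ /has_jacP[_ ->]]]] := smoothing_jacobian oN ylip delta_gt0 xN.
have PB : @uniform_ball R n (@tuple_ball R n) = 1%E.
  rewrite -[@tuple_ball R n]setCK probability_setC; last first.
    by apply: measurableC; exact: measurable_tuple_ball.
  by rewrite [X in (_ - X)%E]uniform_ball_setC sube0.
pose C := [set V | (mxdist V (clarke_jacobian N y x) <= w%:E)%E].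
have convC : @convex_set R 'M[R]_(m, n) C.
  by apply: convex_mxdist; exact: convex_conv_hull.
have CJ : {ae @uniform_ball R n, forall t, @tuple_ball R n t -> C (J t)}.
  apply: filterS aeJ => t Jt Bt; have [dy <-] := has_jacP (Jt Bt).
  set s := x + delta *: rV_of_tuple t.
  have xs : closed_eball x delta s.
    rewrite /closed_eball/= /s addrAC subrr add0r enormZ gtr0_norm//.
    by rewrite ger_pMr.
  rewrite /C/=; apply: le_trans Sw.
  apply: (@le_trans _ _ (ereal_sup [set mxdist V (clarke_jacobian N y x)
      | V in clarke_jacobian N y s])).
    apply: ereal_sup_ubound; exists (Jac y s) => //.
    by apply: clarke_jacobian_diff => //; exact: xN.
  by apply: ereal_sup_ubound; exists s.
(* With this [c], [opnorm_le_sqdist] turns the tolerance [(e / 2 / c) ^+ 2] into at most [e / 2];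
   the other half is the slack of [mxdist_lt]. *)
pose c : R := m%:R * n%:R + 1.
have c0 : 0 < c by rewrite ltr_wpDl// mulr_ge0.
have e2 : 0 < e / 2 by rewrite divr_gt0.
have q0 : 0 < (e / 2 / c) ^+ 2 by rewrite exprn_gt0// divr_gt0.
have [V CV MV] := mean_convex_approx (@measurable_tuple_ball R n) PB mJ JL convC CJ q0.
have [V' SV' VV'] := mxdist_lt CV e2.
exists V' => //; set M := \matrix_(i, j) _.
have -> : M - V' = (M - V) + (V - V') by rewrite addrA subrK.
rewrite (le_lt_trans (opnormD _ _))//.
have MVe : opnorm (M - V) <= e / 2.
  apply: (le_trans (opnorm_le_sqdist _ _)).
  apply: (@le_trans _ _ (m%:R * n%:R * (e / 2 / c))).
    rewrite ler_wpM2l ?mulr_ge0//.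
    rewrite -[leRHS]gtr0_norm ?divr_gt0// -sqrtr_sqr ler_sqrt ?sqr_ge0//.
    exact: ltW.
  by rewrite mulrCA ger_pMr// ler_pdivrMr// mul1r lerDl.
by move: MVe VV'; lra.
Qed.

Lemma clarke_gap_le V : clarke_jacobian N y x V ->
  (clarke_gap X N y phi x <= (bizol_gap X y phi delta x +
    diam X * enorm (d_y y phi x) * opnorm (Jac (smoothing y delta) x - V))%:E)%E.
Proof.
move=> VJ; apply: (@le_trans _ _ (fw_gap X x (d_x y phi x + d_y y phi x *m V))%:E).
  apply: ereal_inf_lbound; exists (d_x y phi x + d_y y phi x *m V) => //.
  exact: clarke_subdiff_chain.
by rewrite lee_fin fw_gap_perturb.
Qed.

Lemma clarke_gap_structural_bias :
  (clarke_gap X N y phi x <= (bizol_gap X y phi delta x)%:E +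
    structural_bias X N y phi delta x)%E.
Proof.
rewrite /structural_bias; set c := diam X * enorm _.
have c0 : 0 <= c by rewrite mulr_ge0 ?enorm_ge0// diam_ge0.
have [V0 V0J] := clarke_jacobian_neq0 oN ylip Nx.
(* The variation is an extended real, with [0 * +oo = 0]; when [c] vanishes, any element of the
   Clarke Jacobian gives the bound. *)
have [cE|cn0] := eqVneq c 0.
  have := clarke_gap_le V0J; rewrite -/c cE mul0r addr0 mul0e adde0.
  by [].
have c_gt0 : 0 < c by rewrite lt_neqAle eq_sym cn0.
have := set_variation_ge0; have := smoothing_jacobian_approx.
case: (set_variation N y x delta) => [w|_ _|//]; last first.
  by rewrite gt0_muley ?lte_fin// addey// leey.
move=> /(_ w (lexx _)) H _; rewrite -EFinM -EFinD.
apply/lee_addgt0Pr => e e0.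
have [V VJ MV] := H (e / c) (divr_gt0 e0 c_gt0).
apply: (le_trans (clarke_gap_le VJ)); rewrite -/c -EFinD lee_fin -addrA lerD2l.
have -> : c * w + e = c * (w + e / c) by rewrite mulrDr mulrCA divff// mulr1.
by rewrite ler_wpM2l// ltW.
Qed.

End main_inequality.

(** An upper bound on the variation makes the threshold on [delta] sufficient for the bias
    condition, but not necessary. The equivalence therefore concerns the majorant [LJc * delta], and
    the bias itself when the variation equals that majorant. *)
Theorem proposition5 (R : realType) (n m : nat)
  (n_gt0 : (0 < n)%N) (m_gt0 : (0 < m)%N)
  (* the feasible set and its neighborhood *)
  (X N : set 'rV[R]_n)
  (X_neq0 : X !=set0) (X_convex : convex_set X) (X_compact : compact X)
  (N_open : open N) (XN : X `<=` N)
  (* the lower level problem and its response map *)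
  (Y : set 'rV[R]_m) (g : 'rV[R]_n -> 'rV[R]_m -> R)
  (y : 'rV[R]_n -> 'rV[R]_m)
  (y_sol : forall x, N x -> argmin Y (g x) = [set y x])
  (y_loclip : locally_lipschitz N y)
  (deltabar : R) (deltabar_gt0 : 0 < deltabar)
  (tubeN : thicken X deltabar `<=` N)
  (y_bounded : exists M : R, forall u, thicken X deltabar u -> enorm (y u) <= M)
  (Ly : R) (y_lip : lipschitz_with Ly (thicken X deltabar) y)
  (* the upper level objective *)
  (phi : 'rV[R]_n * 'rV[R]_m -> R) (phi_C1 : C1 phi)
  (L1x L1y L2x L2y My : R)
  (L1x_gt0 : 0 < L1x) (L1y_gt0 : 0 < L1y)
  (L2x_gt0 : 0 < L2x) (L2y_gt0 : 0 < L2y) (My_gt0 : 0 < My)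
  (* the relevant pairs *)
  (Z : set ('rV[R]_n * 'rV[R]_m)) (Z_graph : forall u, X u -> Z (u, y u))
  (grad1_lip : forall p q, Z p -> Z q ->
    enorm (grad1 phi p - grad1 phi q)
      <= L1x * enorm (p.1 - q.1) + L1y * enorm (p.2 - q.2))
  (grad2_lip : forall p q, Z p -> Z q ->
    enorm (grad2 phi p - grad2 phi q)
      <= L2x * enorm (p.1 - q.1) + L2y * enorm (p.2 - q.2))
  (grad2_bounded : forall p, Z p -> enorm (grad2 phi p) <= My) :
  forall (x : 'rV[R]_n) (delta : R),
    X x -> 0 < delta -> delta <= deltabar ->
  [/\ (clarke_gap X N y phi x <=
         (bizol_gap X y phi delta x)%:E +
         (diam X * enorm (d_y y phi x))%:E * set_variation N y x delta)%E,
      forall eps : R, 0 < eps ->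
        bizol_stationary X y phi delta (2 * eps / 3) x ->
        (structural_bias X N y phi delta x <= (eps / 3)%:E)%E ->
        clarke_fw_stationary X N y phi eps x
    & forall LJc eps : R, 0 < eps ->
        (set_variation N y x delta <= (LJc * delta)%:E)%E ->
        (* the threshold eps / (3 D ||d_y(x)|| LJc) is +oo when D = 0 *)
        let threshold : \bar R :=
          (eps%:E / (3 * diam X * enorm (d_y y phi x) * LJc)%:E)%E in
        (0 < enorm (d_y y phi x) * LJc ->
          [/\ diam X * enorm (d_y y phi x) * (LJc * delta) <= eps / 3 <->
                (delta%:E <= threshold)%E,
              (delta%:E <= threshold)%E ->
                (structural_bias X N y phi delta x <= (eps / 3)%:E)%E
            & set_variation N y x delta = (LJc * delta)%:E ->
                ((structural_bias X N y phi delta x <= (eps / 3)%:E)%E <->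
                 (delta%:E <= threshold)%E)]) /\
        (enorm (d_y y phi x) * LJc = 0 ->
          structural_bias X N y phi delta x = 0%E /\
          (structural_bias X N y phi delta x <= (eps / 3)%:E)%E)].

Proof.
move=> x delta Xx d0 ddb.
have xN : closed_eball x delta `<=` N.
  move=> s sx; apply: tubeN; exists x => //; exists (deltabar^-1 *: (s - x)).
    rewrite /closed_eball/= subr0 enormZ gtr0_norm ?invr_gt0// ler_pdivrMl// mulr1.
    exact: le_trans ddb.
  by rewrite scalerA divff ?gt_eqF// scale1r addrC subrK.
have main := clarke_gap_structural_bias X_neq0 X_compact N_open y_loclip phi_C1 Xx d0 xN.
have v0 := set_variation_ge0 N_open y_loclip d0 xN.
have D0 : 0 <= diam X := diam_ge0 X_neq0 X_compact.
have dy0 : 0 <= enorm (d_y y phi x) := enorm_ge0 _.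
split => //.
  move=> eps eps0 stat bias; rewrite /clarke_fw_stationary.
  apply: (le_trans main).
  apply: (@le_trans _ _ ((2 * eps / 3)%:E + (eps / 3)%:E)%E).
    by apply: leeD => //; rewrite lee_fin.
  by rewrite -EFinD lee_fin; lra.
move=> LJc eps eps0 vL threshold; rewrite /structural_bias.
set D := diam X in D0 threshold *; set dy := enorm _ in dy0 threshold *.
have bias_le : ((D * dy)%:E * set_variation N y x delta <=
    (D * dy * (LJc * delta))%:E)%E.
  by rewrite [leRHS]EFinM lee_wpmul2l// lee_fin mulr_ge0.
split=> [dyL|dyL0].
  have thrP : D * dy * (LJc * delta) <= eps / 3 <-> (delta%:E <= threshold)%E.
    rewrite /threshold inver.
    (* If [D = 0], the extended inverse of 0 is [+oo], so both sides of the equivalence hold. *)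
    have [DE|Dn0] := eqVneq D 0.
      rewrite DE mulr0 !mul0r eqxx gt0_muley ?lte_fin// leey.
      by split=> // _; rewrite divr_ge0// ltW.
    have D_gt0 : 0 < D by rewrite lt_neqAle eq_sym Dn0.
    have c0 : 0 < 3 * D * dy * LJc by rewrite -mulrA mulr_gt0// mulr_gt0.
    rewrite gt_eqF// -EFinM lee_fin ler_pdivlMr// ler_pdivlMr//.
    by have -> : D * dy * (LJc * delta) * 3 = delta * (3 * D * dy * LJc) by ring.
  split => //.
    by move=> /thrP h; apply: (le_trans bias_le); rewrite lee_fin.
  by move=> ->; rewrite -EFinM lee_fin.
(* The bias is squeezed between 0 and its majorant, which contains the vanishing factor
   [dy * LJc]. *)
have bias0 : ((D * dy)%:E * set_variation N y x delta)%E = 0%E.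
  apply/eqP; rewrite eq_le; apply/andP; split.
    apply: (le_trans bias_le); rewrite lee_fin.
    by rewrite mulrA -[D * dy * LJc]mulrA dyL0 mulr0 mul0r.
  by apply: mule_ge0 => //; rewrite lee_fin mulr_ge0.
by split=> //; rewrite bias0 lee_fin divr_ge0// ltW.
Qed.
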